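(* The complete graph $K_4$ is contractible.
   Context: All graphs are finite and simple (no loops or multiple edges). Let $G$ and $H$ be graphs with $V(H)\subseteq V(G)$. An $H$-scheme in $G$ is a collection of paths $\{P_{uv}: uv\in E(H)\}$ such that (1) each $P_{uv}$ is a $u,v$-path in $G$ with $V(P_{uv})\cap V(H)=\{u,v\}$, and (2) whenever $e_1,\dots,e_k\in E(H)$ satisfy $V(P_{e_1})\cap\dots\cap V(P_{e_k})\neq\emptyset$, there is a vertex $u\in V(H)$ incident with each of $e_1,\dots,e_k$. $G$ has a rooted $H$-minor if there are pairwise vertex-disjoint connected subgraphs $C_v$ of $G$, one for each $v\in V(H)$, such that $v\in V(C_v)$ for all $v\in V(H)$ and for each edge $uv\in E(H)$ there is an edge of $G$ joining $C_u$ and $C_v$. A graph $H$ is contractible if every graph $G$ with $V(H)\subseteq V(G)$ that contains an $H$-scheme has a rooted $H$-minor. *)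

(* Defs.v *)
From HB Require Import structures.
From mathcomp Require Import all_boot.

Set Implicit Arguments.
Unset Strict Implicit.
Unset Printing Implicit Defensive.

Record sgraph := SGraph {
  vertex :> finType;
  adj : rel vertex;
  adj_sym : symmetric adj;
  adj_irrefl : irreflexive adj
}.

Definition edges (H : sgraph) : {set {set H}} :=
  [set e : {set H} | [exists u, exists v, adj u v && (e == [set u; v])]].

Fact neq_sym (T : eqType) : symmetric (fun x y : T => x != y).
Proof. by move=> x y; rewrite eq_sym. Qed.

Fact neq_irrefl (T : eqType) : irreflexive (fun x y : T => x != y).
Proof. by move=> x; rewrite eqxx. Qed.

Definition complete_graph (n : nat) : sgraph :=
  @SGraph 'I_n (fun x y => x != y) (@neq_sym _) (@neq_irrefl _).

(* A path is represented by the sequence of its vertices, listed from one end *)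
(* to the other.                                                              *)
Definition path_from_to (G : sgraph) (x y : G) (s : seq G) : Prop :=
  exists p : seq G,
    [/\ s = x :: p, path (@adj G) x p, last x p = y & uniq s].

(* Paths are undirected, so either end may come first in the sequence. *)
Definition is_path (G : sgraph) (x y : G) (s : seq G) : Prop :=
  path_from_to x y s \/ path_from_to y x s.

Record subgraph (G : sgraph) := Subgraph {
  sub_vertices : {set G};
  sub_adj : rel G;
  sub_adj_sym : symmetric sub_adj;
  sub_adj_vertices :
    forall x y, sub_adj x y -> (x \in sub_vertices) && (y \in sub_vertices);
  sub_adj_adj : forall x y, sub_adj x y -> adj x y
}.

Definition connected_subgraph (G : sgraph) (C : subgraph G) : Prop :=
  sub_vertices C != set0 /\
  {in sub_vertices C &, forall x y, connect (sub_adj C) x y}.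

(* The inclusion of V(H) in V(G) is rendered by an injection i : H -> G; the *)
(* edges of H need not be edges of G.                                        *)
(* The path attached to the edge uv is P [set u; v]; values of P outside      *)
(* edges H are irrelevant. In the second clause F stands for {e_1, ..., e_k}, *)
(* with k >= 1.                                                               *)
Definition is_scheme (H G : sgraph) (i : H -> G)
    (P : {set H} -> seq G) : Prop :=
  (forall u v : H, adj u v ->
     is_path (i u) (i v) (P [set u; v]) /\
     [set x in P [set u; v]] :&: [set i w | w : H] = [set i u; i v]) /\
  (forall F : {set {set H}}, F \subset edges H -> F != set0 ->
     (exists x : G, forall e, e \in F -> x \in P e) ->
     exists u : H, forall e, e \in F -> u \in e).

Definition has_scheme (H G : sgraph) (i : H -> G) : Prop := exists P : {set H} -> seq G, is_scheme i P.

Definition has_rooted_minor (H G : sgraph) (i : H -> G) : Prop :=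
  exists C : H -> subgraph G,
    [/\ forall v, connected_subgraph (C v),
        forall u v, u != v ->
          [disjoint sub_vertices (C u) & sub_vertices (C v)],
        forall v, i v \in sub_vertices (C v)
      & forall u v, adj u v ->
          exists x y, [/\ x \in sub_vertices (C u), y \in sub_vertices (C v)
                        & adj x y]].

Definition contractible (H : sgraph) : Prop :=
  forall (G : sgraph) (i : H -> G), injective i ->
    has_scheme i -> has_rooted_minor i.

(* Main.v *)
Require Import Defs.
From mathcomp Require Import all_boot zify.

Set Implicit Arguments.
Unset Strict Implicit.
Unset Printing Implicit Defensive.

(* Colouring a vertex with a root common to all the edges of K4 whose paths use
   it turns a K4-scheme into a 4-colouring of G in which each root has its own
   colour and any two roots are joined by a path using only their two colours (a
   Kempe chain); the converse also holds. Consider such a G with as few vertices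
   as possible. A monochromatic edge can be contracted, and if two vertices
   separate G then one side can be recoloured so as to create a monochromatic
   edge; so G is 3-connected. By Dirac's argument, either three roots lie on a
   cycle to which the fourth one attaches on each of the three arcs, which is a
   rooted K4, or all four roots lie on a cycle. In the latter case the Kempe
   chains between the two pairs of opposite roots are disjoint; contracting them
   towards the roots ends with two crossing chords, again a rooted K4. *)

(** The paths of a scheme may meet freely near a common root, and such a family is awkward to
    maintain while the graph shrinks. A colouring keeps only what matters: the chain for the pair
    [i], [j] is any walk in the vertices coloured [i] or [j]. Contracting an edge with both ends of
    one colour, or recolouring a part, thus leaves an object of the same kind, and chains for
    disjoint pairs are disjoint for free. When no monochromatic edge remains, a root has neighbours
    of the three other colours, which together with 3-connectivity gives a cycle to start from. All
    graphs live on one fixed type [T]: a stage of the reduction is a vertex set [V] with a relation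
    [e]. *)

Lemma ord4_uniq (i j k l : 'I_4) : uniq [:: i; j; k; l] ->
  forall h, h \in [:: i; j; k; l].
Proof.
move=> u h; have /(uniq_min_size u) : {subset [:: i; j; k; l] <= enum 'I_4}.
  by move=> ? _; rewrite mem_enum.
by rewrite size_enum_ord => /(_ isT)[_ /(_ h)]; rewrite mem_enum.
Qed.

Lemma ord4_others (i : 'I_4) : exists j k l, uniq [:: i; j; k; l].
Proof.
have P := perm_to_rem (mem_enum 'I_4 i).
have := perm_size P; have := perm_uniq P; rewrite enum_uniq size_enum_ord.
by case: (rem i _) => [|j [|k [|l []]]] //= u _; exists j, k, l; rewrite /= -u.
Qed.

Lemma ord4_pairs (i j k l : 'I_4) (Q : 'I_4 -> 'I_4 -> Prop) :
  uniq [:: i; j; k; l] -> (forall a b, Q a b -> Q b a) -> (forall a, Q a a) ->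
  [/\ Q i j, Q i k & Q i l] -> [/\ Q j k, Q j l & Q k l] -> forall a b, Q a b.
Proof.
move=> /ord4_uniq in4 Qs Qr [ij ik il] [jk jl kl] a b.
have := in4 a; have := in4 b; rewrite !inE.
by case/or4P=> /eqP-> /or4P[] /eqP->; try apply: Qr; do ?[by []|apply: Qs].
Qed.

(** * Connectivity, rooted K4 models and contraction *)

Section Graph.
Variable T : finType.
Implicit Types (e : rel T) (A B U V : {set T}) (x y z : T).

(** Each step must stay in [A], but the empty walk makes [conn e A x x] true even for [x] outside
    [A]; several lemmas below therefore ask for distinct ends. *)
Definition conn e A x y :=
  connect (fun u v => [&& u \in A, v \in A & e u v]) x y.

Lemma connxx e A x : conn e A x x. Proof. exact: connect0. Qed.

Lemma conn1 e A x y : x \in A -> y \in A -> e x y -> conn e A x y.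
Proof. by move=> xA yA exy; apply: connect1; rewrite xA yA. Qed.

Lemma conn_trans e A y x z : conn e A x y -> conn e A y z -> conn e A x z.
Proof. exact: connect_trans. Qed.

Lemma conn_sym e A x y : symmetric e -> conn e A x y -> conn e A y x.
Proof.
move=> syme; rewrite /conn sym_connect_sym // => u v /=.
by rewrite syme andbCA.
Qed.

Lemma conn_inv e A x y (Q : T -> Prop) :
  (forall u v, u \in A -> v \in A -> e u v -> Q u -> Q v) ->
  conn e A x y -> Q x -> Q y.
Proof.
move=> stepQ /connectP[p]; elim: p x => [|z p IHp] x /= => [_ -> //|].
by case/andP=> /and3P[xA zA exz] zp yp Qx; apply: IHp (stepQ _ _ xA zA exz Qx).
Qed.

Lemma conn_sub e e' A B x y :
  (forall u v, u \in A -> v \in A -> e u v -> conn e' B u v) ->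
  conn e A x y -> conn e' B x y.
Proof.
move=> sub cxy;
  apply: (conn_inv (Q := conn e' B x) _ cxy (connxx _ _ _)) => u v uA vA euv.
by move/conn_trans; apply; apply: sub.
Qed.

Lemma connS e A B x y : A \subset B -> conn e A x y -> conn e B x y.
Proof.
by move/subsetP=> AB; apply: conn_sub => u v uA vA; apply: conn1; apply: AB.
Qed.

Lemma conn_first e A x y : conn e A x y -> x != y ->
  exists z, [/\ z \in A, x \in A, z != x & e x z].
Proof.
(* [shortenP] makes the walk simple, so the vertex after [x] differs from [x] even if [e] has a loop
   there. *)
move=> /connectP[p xp ->]; case/shortenP: xp => -[|z q] /=; first by rewrite eqxx.
case/andP=> /and3P[xA zA exz] _ /andP[+ _] _ _; rewrite inE negb_or => /andP[xz _].
by exists z; rewrite eq_sym.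
Qed.

Lemma conn_memr e A x y : conn e A x y -> x != y -> y \in A.
Proof.
case/connectP; elim/last_ind=> [|p z _] /=; first by move=> _ ->; rewrite eqxx.
by rewrite rcons_path last_rcons => /andP[_ /and3P[_ zA _]] ->.
Qed.

Lemma conn_path e A x y : conn e A x y -> x \in A ->
  exists p, [/\ path e x p, last x p = y, uniq (x :: p) & {subset x :: p <= A}].
Proof.
case/connectP=> p xp ->; case/shortenP: xp => q xq uq _ xA.
exists q; split=> //; first by apply: sub_path xq => u v /and3P[].
suff: all [in A] q by move=> /allP qA z; rewrite inE => /predU1P[->|/qA].
by elim: q x xq {uq xA} => //= z q IH x /andP[/and3P[_ -> _]] /IH.
Qed.

Lemma path_conn e A x p : path e x p -> {subset x :: p <= A} ->
  {in x :: p, forall z, conn e A x z}.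
Proof.
elim: p x => [|y p IHp] x /= => [_ _ z|/andP[exy yp] sub z].
  by rewrite inE => /eqP->; apply: connxx.
have sub': {subset y :: p <= A} by move=> u up; apply: sub; rewrite inE up orbT.
rewrite inE => /predU1P[->|/(IHp _ yp sub')]; first exact: connxx.
by apply: conn_trans; apply: conn1 => //; apply: sub; rewrite !inE eqxx ?orbT.
Qed.

Definition connected e A := {in A &, forall x y, conn e A x y}.

Lemma connected_path e x p : symmetric e -> path e x p ->
  connected e [set z in x :: p].
Proof.
move=> syme xp y z; rewrite !in_set => yp zp.
have H := path_conn xp (fun u up => etrans (in_set _ u) up).
by apply: conn_trans (H _ zp); apply: conn_sym (H _ yp).
Qed.

Lemma connected_component e A x : symmetric e -> x \in A ->
  connected e [set z in A | conn e A x z].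
Proof.
move=> syme xA; set H := [set _ in _ | _].
have c1 y : y \in H -> conn e H x y.
  rewrite inE => /andP[_ cxy].
  have [] // : conn e A x y /\ conn e H x y.
  apply: (conn_inv (Q := fun y => conn e A x y /\ conn e H x y) _ cxy);
    last by split; apply: connxx.
  move=> u v uA vA euv [cu hu]; have cv: conn e A x v.
    by apply: conn_trans cu (conn1 _ _ _).
  by split=> //; apply: conn_trans hu (conn1 _ _ _); rewrite // inE ?uA ?vA.
by move=> y z /c1 yH /c1; apply: conn_trans; apply: conn_sym yH.
Qed.

Definition adjacent e A B := exists x y, [/\ x \in A, y \in B & e x y].

Lemma adjacent_sym e A B : symmetric e -> adjacent e A B -> adjacent e B A.
Proof. by move=> syme [x [y [xA yB exy]]]; exists y, x; rewrite syme. Qed.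

Section Model.
Variable r : 'I_4 -> T.

(** A rooted K4-minor with branch sets [M i], relative to [V] and [e] so that it can be pulled back
    along contractions. *)
Definition model V e :=
  exists M : 'I_4 -> {set T},
  [/\ forall i, M i \subset V, forall i, r i \in M i,
      forall i, connected e (M i), forall i j, i != j -> [disjoint M i & M j]
    & forall i j, i != j -> adjacent e (M i) (M j)].

Lemma model_intro V e (i j k l : 'I_4) (A B C D : {set T}) :
  symmetric e -> uniq [:: i; j; k; l] ->
  [/\ A \subset V, B \subset V, C \subset V & D \subset V] ->
  [/\ r i \in A, r j \in B, r k \in C & r l \in D] ->
  [/\ connected e A, connected e B, connected e C & connected e D] ->
  [/\ [disjoint A & B], [disjoint A & C] & [disjoint A & D]] ->
  [/\ [disjoint B & C], [disjoint B & D] & [disjoint C & D]] ->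
  [/\ adjacent e A B, adjacent e A C & adjacent e A D] ->
  [/\ adjacent e B C, adjacent e B D & adjacent e C D] ->
  model V e.
Proof.
move=> syme u [sA sB sC sD] [rA rB rC rD] [cA cB cC cD].
move=> [AB AC AD] [BC BD CD] [aAB aAC aAD] [aBC aBD aCD].
have := u; rewrite /= !inE !negb_or => /and4P[/and3P[ij ik il] /andP[jk jl] kl _].
pose M h := if h == i then A else if h == j then B else if h == k then C else D.
have Mi : M i = A by rewrite /M eqxx.
have Mj : M j = B by rewrite /M eqxx [j == i]eq_sym (negPf ij).
have Mk : M k = C.
  by rewrite /M eqxx [k == i]eq_sym [k == j]eq_sym (negPf ik) (negPf jk).
have Ml : M l = D.
  rewrite /M [l == i]eq_sym [l == j]eq_sym [l == k]eq_sym.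
  by rewrite (negPf il) (negPf jl) (negPf kl).
have all4 (Q : 'I_4 -> Prop) : Q i -> Q j -> Q k -> Q l -> forall h, Q h.
  move=> Qi Qj Qk Ql h; have := ord4_uniq u h; rewrite !inE.
  by case/or4P=> /eqP->.
exists M; split.
- by apply: (all4 (fun h => M h \subset V)); rewrite ?Mi ?Mj ?Mk ?Ml.
- by apply: (all4 (fun h => r h \in M h)); rewrite ?Mi ?Mj ?Mk ?Ml.
- by apply: (all4 (fun h => connected e (M h))); rewrite ?Mi ?Mj ?Mk ?Ml.
- apply: (ord4_pairs u); [| | by rewrite Mi Mj Mk Ml | by rewrite Mj Mk Ml].
  + by move=> a b dab; rewrite eq_sym disjoint_sym.
  + by move=> a; rewrite eqxx.
- apply: (ord4_pairs u); [| | by rewrite Mi Mj Mk Ml | by rewrite Mj Mk Ml].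
  + by move=> a b adj_ab; rewrite eq_sym => /adj_ab; apply: adjacent_sym.
  + by move=> a; rewrite eqxx.
Qed.

Lemma modelS V V' e : V' \subset V -> model V' e -> model V e.
Proof.
move=> VV [M [MV rM cM dM aM]]; exists M; split=> // i.
exact: subset_trans (MV i) VV.
Qed.

End Model.

(* [contract e x y] merges [y] into [x]; the vertex [y] has then to be removed
   from the vertex set. A loop at [x] may appear, which is harmless. *)
Definition contract e x y : rel T :=
  fun u v => [|| e u v, (u == x) && e y v | (v == x) && e u y].

Lemma contract_sym e x y : symmetric e -> symmetric (contract e x y).
Proof.
by move=> syme u v; rewrite /contract syme [e y v]syme [e u y]syme [RHS]orbA
  [RHS]orbAC -orbA.
Qed.

Lemma contractW e x y u v : e u v -> contract e x y u v.
Proof. by rewrite /contract => ->. Qed.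

(** The image of the walk under the map [g], which sends [y] to [x], is a walk up to stationary
    steps; it stays in [A] because [x] is in [A] as soon as [y] is. *)
Lemma conn_contract e A x y a b : symmetric e -> (y \in A -> x \in A) -> x != y ->
  a != y -> b != y -> conn e A a b -> conn (contract e x y) (A :\ y) a b.
Proof.
move=> syme yxA xy ay by_ cab; pose g z := if z == y then x else z.
suff: conn (contract e x y) (A :\ y) (g a) (g b).
  by rewrite /g (negPf ay) (negPf by_).
set e' := contract e x y; set A' := A :\ y.
apply: (conn_inv (Q := fun z => conn e' A' (g a) (g z)) _ cab (connxx _ _ _)).
move=> u v uA vA euv /conn_trans; apply.
have gA z : z \in A -> g z \in A :\ y.
  rewrite /g !inE; have [->|zy] := eqVneq z y => zA; last by rewrite zA zy.
  by rewrite xy yxA.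
have gu := gA _ uA; have gv := gA _ vA.
have [->|] := eqVneq (g u) (g v); first exact: connxx.
move=> guv; apply: conn1 => //; rewrite /e' /contract; move: guv; rewrite /g.
have [uy|_] := eqVneq u y; have [vy|_] := eqVneq v y; rewrite ?eqxx //.
- by rewrite -uy euv orbT.
- by rewrite -vy euv !orbT.
- by rewrite euv.
Qed.

(** The branch set containing [x], if there is one, also receives [y]; an edge created by the
    contraction then unfolds into an edge at [y]. *)
Lemma model_contract r V e x y : symmetric e -> e x y -> x \in V -> y \in V ->
  model r (V :\ y) (contract e x y) -> model r V e.
Proof.
move=> syme exy xV yV [M [MV rM cM dM aM]].
pose N i := if x \in M i then y |: M i else M i.
have yM i : y \notin M i by apply/negP => /(subsetP (MV i)); rewrite !inE eqxx.
have MN i : M i \subset N i by rewrite /N; case: ifP => _ //; apply: subsetU1.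
exists N; split.
- move=> i; have MVi: M i \subset V := subset_trans (MV i) (subsetDl _ _).
  by rewrite /N; case: ifP => _ //; rewrite subUset sub1set yV.
- by move=> i; apply: (subsetP (MN i)).
- move=> i.
  have cMN u v : u \in M i -> v \in M i -> conn e (N i) u v.
    move=> ui vi; apply: conn_sub (cM i _ _ ui vi) => {ui vi} {}u {}v ui vi.
    have Nu := subsetP (MN i) _ ui; have Nv := subsetP (MN i) _ vi.
    case/or3P=> [euv|/andP[/eqP ux eyv]|/andP[/eqP vx euy]].
    + exact: conn1.
    + have yN : y \in N i by rewrite /N -ux ui setU11.
      by apply: (conn_trans (y := y)); apply: conn1; rewrite // ux.
    + have yN : y \in N i by rewrite /N -vx vi setU11.
      by apply: (conn_trans (y := y)); apply: conn1; rewrite // vx syme.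
  rewrite /connected /N in cMN *; case: ifP cMN => // xi cMN u v.
  have xyc : conn e (y |: M i) x y.
    by apply: conn1; rewrite // !inE ?xi ?eqxx ?orbT.
  rewrite !inE => /predU1P[->|ui] /predU1P[->|vi].
  + exact: connxx.
  + by apply: conn_trans (cMN _ _ xi vi); apply: conn_sym xyc.
  + by apply: conn_trans xyc; apply: cMN.
  + exact: cMN.
- move=> i j ij; have dij := dM i j ij.
  have aux k k' : [disjoint M k & M k'] -> x \in M k -> [disjoint y |: M k & N k'].
    move=> dk xk; rewrite /N (disjointFr dk xk) disjoints_subset.
    by rewrite subUset sub1set inE yM -disjoints_subset.
  rewrite {1}/N; case: ifP => xi; first exact: aux.
  rewrite /N; case: ifP => xj //; rewrite disjoint_sym.
  by have := aux j i; rewrite /N xi disjoint_sym; apply.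
- move=> i j /aM[u [v [ui vj]]].
  have Nu := subsetP (MN i) _ ui; have Nv := subsetP (MN j) _ vj.
  case/or3P=> [euv|/andP[/eqP ux eyv]|/andP[/eqP vx euy]].
  + by exists u, v.
  + by exists y, v; split=> //; rewrite /N -ux ui setU11.
  + by exists u, y; split=> //; rewrite /N -vx vj setU11.
Qed.

End Graph.

(** * Two disjoint crossing paths on a cycle *)

Section CrossedCycle.
Variables (T : finType) (r : 'I_4 -> T).
Implicit Types (e : rel T) (V : {set T}) (f : pred T).

(** The lists [a1] to [a4] are the open arcs between consecutive roots of a cycle. Placing the two
    chains on either side of a predicate [f] makes them disjoint and lets contractions keep them
    so. *)
Record crossed V e f (i j k l : 'I_4) (a1 a2 a3 a4 : seq T) : Prop := Crossed {
  crossed_ord : uniq [:: i; j; k; l];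
  crossed_uniq :
    uniq ((r i :: a1) ++ (r j :: a2) ++ (r k :: a3) ++ (r l :: a4));
  crossed_sub :
    {subset (r i :: a1) ++ (r j :: a2) ++ (r k :: a3) ++ (r l :: a4) <= V};
  crossed_ij : path e (r i) (rcons a1 (r j));
  crossed_jk : path e (r j) (rcons a2 (r k));
  crossed_kl : path e (r k) (rcons a3 (r l));
  crossed_li : path e (r l) (rcons a4 (r i));
  crossed_ik : conn e (V :&: [set x | f x]) (r i) (r k);
  crossed_jl : conn e (V :&: [set x | ~~ f x]) (r j) (r l)
}.

Lemma rev_seg e x y s : symmetric e -> path e x (rcons s y) ->
  path e y (rcons (rev s) x).
Proof.
move=> syme; rewrite -rev_cons -[in X in _ -> X](last_rcons x s y).
by rewrite -[x :: s](belast_rcons x s y) rev_path (eq_path (e' := e)).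
Qed.

(** A shift by one root exchanges the two chains, hence the complement of [f]; it lets statements
    about [r i] be applied to the other roots. *)
Lemma crossed_rot V e f i j k l a1 a2 a3 a4 : symmetric e ->
  crossed V e f i j k l a1 a2 a3 a4 ->
  crossed V e (predC f) j k l i a2 a3 a4 a1.
Proof.
move=> syme [ord unq sub ij jk kl li ik jl]; split=> //.
- by move: ord; rewrite (uniq_catC [:: i] [:: j; k; l]).
- by move: unq; rewrite uniq_catC -!catA.
- by move=> z Hz; apply: sub; rewrite mem_cat orbC -mem_cat -!catA.
- apply: conn_sym => //; congr conn: ik.
  by apply/setP => z; rewrite !inE /= negbK.
Qed.

Lemma crossed_rev V e f i j k l a1 a2 a3 a4 : symmetric e ->
  crossed V e f i j k l a1 a2 a3 a4 ->
  crossed V e f i l k j (rev a4) (rev a3) (rev a2) (rev a1).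
Proof.
move=> syme [ord unq sub ij jk kl li ik jl].
have P : perm_eq ((r i :: rev a4) ++ (r l :: rev a3) ++ (r k :: rev a2) ++
      (r j :: rev a1))
    ((r i :: a1) ++ (r j :: a2) ++ (r k :: a3) ++ (r l :: a4)).
  by apply/permP => Q; rewrite !count_cat /= !count_rev; lia.
split; try exact: rev_seg.
- rewrite -(perm_uniq (s1 := [:: i; j; k; l])) //.
  by apply/permP => Q /=; lia.
- by rewrite (perm_uniq P).
- by move=> z; rewrite (perm_mem P); apply: sub.
- by [].
- exact: conn_sym.
Qed.

(** Generalised over the graph and the cycle, since the induction on [n] applies it to contracted
    graphs. *)
Definition crossed_claim n := forall V e f i j k l a1 a2 a3 a4,
  symmetric e -> #|V| <= n -> crossed V e f i j k l a1 a2 a3 a4 -> model r V e.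

Lemma path_contract_head e x y s :
  path e y s -> path (contract e x y) x s.
Proof.
case: s => //= z s /andP[eyz zs]; apply/andP; split.
  by rewrite /contract eqxx eyz orbT.
by apply: sub_path zs; apply: contractW.
Qed.

Lemma path_contract_last e x y z s :
  path e z (rcons s y) -> path (contract e x y) z (rcons s x).
Proof.
rewrite !rcons_path => /andP[zs ey]; apply/andP; split.
  by apply: sub_path zs; apply: contractW.
by rewrite /contract eqxx ey !orbT.
Qed.

Lemma crossed_fi V e f i j k l a1 a2 a3 a4 :
  crossed V e f i j k l a1 a2 a3 a4 ->
  exists p, [/\ f (r i), f p, p \in V, e (r i) p & p != r i].
Proof.
case=> ord unq _ _ _ _ _ ik _.
have rik : r i != r k.
  apply: contraL unq => /eqP->.
  by rewrite /= !(mem_cat, inE) eqxx !orbT.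
have [p []] := conn_first ik rik; rewrite !inE.
by move=> /andP[pV fp] /andP[_ fi] pi eip; exists p.
Qed.

(** The vertex [p] is merged into [r i]. If it lies on an arc ending at [r i], the part of the arc
    between them is dropped. The other chain avoids [p], which is on the side of [f]. *)
Lemma crossed_contract n V e f i j k l a1 a2 a3 a4 p :
  crossed_claim n -> symmetric e -> #|V| <= n.+1 ->
  crossed V e f i j k l a1 a2 a3 a4 ->
  f p -> p \in V -> e (r i) p ->
  p \notin r i :: (r j :: a2) ++ (r k :: a3) ++ [:: r l] -> model r V e.
Proof.
move=> IH syme leV cr fp pV eip pN.
have [_ [fi _ _ _ _]] := crossed_fi cr.
have unq := crossed_uniq cr; have iV : r i \in V.
  by apply: (crossed_sub cr); rewrite mem_head.
have ip : r i != p by apply: contraNneq pN => <-; rewrite mem_head.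
pose e' := contract e (r i) p.
have small a1' a4' : subseq a1' a1 -> subseq a4' a4 -> p \notin a1' ++ a4' ->
    path e' (r i) (rcons a1' (r j)) -> path e' (r l) (rcons a4' (r i)) ->
    model r V e.
  move=> s1 s4 p14 p1 p4; apply: (model_contract syme eip iV pV).
  apply: (IH _ e' f i j k l a1' a2 a3 a4').
  - exact: contract_sym.
  - by move: leV; rewrite (cardsD1 p V) pV.
  have sub : subseq ((r i :: a1') ++ (r j :: a2) ++ (r k :: a3) ++ (r l :: a4'))
      ((r i :: a1) ++ (r j :: a2) ++ (r k :: a3) ++ (r l :: a4)).
    by do 3![apply: cat_subseq; rewrite /= ?eqxx //].
  have ee' : subrel e e' by move=> u v; apply: contractW.
  have pN' : p \notin (r i :: a1') ++ (r j :: a2) ++ (r k :: a3) ++ (r l :: a4').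
    move: p14; rewrite mem_cat negb_or => /andP[/negPf n1 /negPf n4].
    by move: pN; rewrite !(inE, mem_cat) n1 n4 /= ?orbF.
  split=> //.
  - exact: crossed_ord cr.
  - exact: subseq_uniq sub unq.
  - move=> z zO; rewrite !inE (crossed_sub cr (mem_subseq sub zO)) andbT.
    by apply: contraNneq pN' => <-.
  - by apply: sub_path (crossed_jk cr).
  - by apply: sub_path (crossed_kl cr).
  - rewrite setIDAC; apply: conn_contract (crossed_ik cr) => //.
    + by rewrite !inE fi iV.
    + by apply: contraNneq pN' => <-; rewrite !(inE, mem_cat) eqxx !orbT.
  - rewrite setIDAC; apply: conn_contract (crossed_jl cr) => //.
    + by rewrite !inE fp andbF.
    + by apply: contraNneq pN' => <-; rewrite !(inE, mem_cat) eqxx !orbT.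
    + by apply: contraNneq pN' => <-; rewrite !(inE, mem_cat) eqxx !orbT.
have subp s x : path e x s -> path e' x s.
  by apply: sub_path => u v; apply: contractW.
(* The first arc now begins after [p], whose neighbours [r i] inherits. *)
have [pa1|pa1] := boolP (p \in a1).
  have pa4 : p \notin a4.
    move: unq; rewrite cat_uniq => /and3P[_ /hasPn H _].
    by apply: contraL pa1 => pa4; have := H p;
      rewrite !(inE, mem_cat) pa4 !orbT => /(_ isT); rewrite negb_or => /andP[].
  have := crossed_ij cr; have u1 : uniq a1.
    by move: unq; rewrite cat_uniq /= => /andP[/andP[_ ->]].
  case/splitPr: pa1 u1 small => b b' u1 small.
  rewrite rcons_cat cat_path /= => /and3P[_ _ pb'].
  apply: (small b' a4) => //.
  - by rewrite -cat_rcons suffix_subseq.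
  - rewrite mem_cat negb_or pa4 andbT.
    by move: u1; rewrite cat_uniq /= => /and4P[].
  - exact: path_contract_head.
  - exact/subp/(crossed_li cr).
have [pa4|pa4] := boolP (p \in a4).
  have := crossed_li cr; have u4 : uniq a4.
    by move: unq; rewrite !catA cat_uniq /= => /and4P[_ _ _ ->].
  case/splitPr: pa4 u4 small => b b' u4 small.
  rewrite rcons_cat -cat_rcons cat_path => /andP[pb _].
  apply: (small a1 b) => //.
  - exact: prefix_subseq.
  - rewrite mem_cat negb_or pa1.
    by move: u4; rewrite uniq_catC /= mem_cat negb_or => /andP[/andP[]].
  - exact/subp/(crossed_ij cr).
  - exact: path_contract_last.
apply: (small a1 a4) => //; last 2 first.
- exact/subp/(crossed_ij cr).
- exact/subp/(crossed_li cr).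
by rewrite mem_cat negb_or pa1.
Qed.

Lemma adjacent_list e x s y t :
  path e x (rcons s y) -> adjacent e [set z in x :: s] [set z in y :: t].
Proof.
rewrite rcons_path => /andP[_ exy].
by exists (last x s), y; rewrite !in_set mem_last mem_head.
Qed.

Lemma disjoint_list (s t : seq T) : uniq (s ++ t) ->
  [disjoint [set z in s] & [set z in t]].
Proof.
rewrite cat_uniq => /and3P[_ /hasPn st _].
rewrite disjoint_sym disjoint_subset; apply/subsetP => z; rewrite !inE.
exact: st.
Qed.

(* The chords from [r i] to [p] and from [r j] to [q] cross: unless [q] can be
   contracted into [r j], it lies on the arc from [r k] to [r i]. *)
Lemma crossed_half n V e f i j k l a1 a2 a3 a4 p :
  crossed_claim n -> symmetric e -> #|V| <= n.+1 ->
  crossed V e f i j k l a1 a2 a3 a4 ->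
  e (r i) p -> p \in rcons a2 (r k) -> model r V e.
Proof.
move=> IH syme leV cr eip pa2.
have cr1 := crossed_rot syme cr.
have [q [/= fj fq qV ejq qj]] := crossed_fi cr1.
have [qN|] := boolP (q \in r j :: (r k :: a3) ++ (r l :: a4) ++ [:: r i]);
  last first.
  exact: crossed_contract IH syme leV cr1 fq qV ejq.
have [_ [fi _ _ _ _]] := crossed_fi cr.
have [_ [/= fk _ _ _ _]] := crossed_fi (crossed_rot syme cr1).
rewrite negbK in fk.
(* [q] is outside [f], whereas [r k] and [r i] satisfy [f]. *)
have {}qN : q \in a3 ++ r l :: a4.
  move: qN; rewrite !(inE, mem_cat) (negPf qj) /=.
  by case: eqP fq => [->|_]; rewrite ?fk //=; case: (q =P r i) => [->|];
    rewrite ?fi ?orbF.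
have [ord unq sub ij jk kl li _ _] := cr.
have [b [b' def2]] : exists b b', rcons a2 (r k) = b ++ p :: b'.
  by case/splitPr: pa2 => b b'; exists b, b'.
(* The cycle is cut into four arcs, starting at [r i], at [r j], at [p] and just after [r k].
   Consecutive arcs are adjacent along the cycle, opposite ones through the two chords. *)
pose L1 := r i :: a1; pose L2 := r j :: b; pose L3 := p :: b'.
pose L4 := a3 ++ r l :: a4.
have defO : (r i :: a1) ++ (r j :: a2) ++ (r k :: a3) ++ (r l :: a4)
    = L1 ++ L2 ++ L3 ++ L4.
  by rewrite /L1 /L2 /L3 /L4 /= -(cat_rcons (r k) a2) def2 -catA.
have unq' : uniq (L1 ++ L2 ++ L3 ++ L4) by rewrite -defO.
have sub' L : {subset L <= L1 ++ L2 ++ L3 ++ L4} -> [set z in L] \subset V.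
  by move=> LO; apply/subsetP => z; rewrite inE => /LO; rewrite -defO => /sub.
have kL3 : r k = last p b' by rewrite -[RHS](last_cat (r k) b (p :: b')) -def2
  last_rcons.
move: jk; rewrite def2 cat_path /= => /and3P[pb ebp pb'].
have [h [t defL4]] : exists h t, L4 = h :: t by rewrite /L4; case: (a3) => [|h t];
  [exists (r l), a4 | exists h, (t ++ r l :: a4)].
have path4 : path e (r k) (rcons L4 (r i)).
  by rewrite /L4 rcons_cat /= -cat_rcons cat_path last_rcons kl.
have := path4; rewrite defL4 /= => /andP[ekh pt].
apply: (@model_intro _ r V e i j k l [set z in L1] [set z in L2] [set z in L3] [set
  z in L4]) => //.
- by split; apply: sub' => z; rewrite !mem_cat => ->; rewrite ?orbT.
- split; rewrite in_set ?mem_head //; first by rewrite kL3 mem_last.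
  by rewrite mem_cat mem_head orbT.
- split; try exact: connected_path.
  + by apply: connected_path => //; move: ij; rewrite rcons_path => /andP[].
  + rewrite defL4; apply: connected_path => //.
    by move: pt; rewrite rcons_path => /andP[].
- split; apply: disjoint_list.
  + by move: unq'; rewrite catA cat_uniq => /andP[].
  + apply: subseq_uniq unq'; rewrite cat_subseq //.
    by apply: (subseq_trans (y := L3 ++ L4));
      [exact: prefix_subseq | exact: suffix_subseq].
  + apply: subseq_uniq unq'; rewrite cat_subseq //.
    by rewrite catA; exact: suffix_subseq.
- move: unq'; rewrite cat_uniq => /and3P[_ _ unq'].
  split; apply: disjoint_list.
  + by move: unq'; rewrite catA cat_uniq => /andP[].
  + by apply: subseq_uniq unq'; rewrite cat_subseq // suffix_subseq.
  + by move: unq'; rewrite cat_uniq => /and3P[].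
- split.
  + exact: adjacent_list.
  + by exists (r i), p; rewrite !inE !eqxx.
  + apply: adjacent_sym => //; rewrite defL4; apply: adjacent_list.
    by [].
- split.
  + by apply: adjacent_list; rewrite rcons_path pb.
  + by exists (r j), q; rewrite in_set mem_head inE.
  + rewrite defL4; apply: adjacent_list.
    by rewrite rcons_path pb' -kL3.
Qed.

Lemma model_crossed n : crossed_claim n.
Proof.
elim: n => [|n IH] V e f i j k l a1 a2 a3 a4 syme leV cr.
  have : r i \in V by apply: (crossed_sub cr); rewrite mem_head.
  by move: leV; rewrite leqn0 cards_eq0 => /eqP->; rewrite inE.
have [p [fi fp pV eip pi]] := crossed_fi cr.
have [pN|] := boolP (p \in r i :: (r j :: a2) ++ (r k :: a3) ++ [:: r l]);
  last first.
  exact: crossed_contract IH syme leV cr fp pV eip.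
have cr1 := crossed_rot syme cr; have [_ [/= fj _ _ _ _]] := crossed_fi cr1.
have := crossed_rot syme (crossed_rot syme cr1).
case/crossed_fi=> _ [/= fl _ _ _ _]; rewrite !negbK in fl.
have [p2|p2] := boolP (p \in rcons a2 (r k)).
  exact: crossed_half IH syme leV cr eip p2.
(* The reflected cycle has [rev a3] as its second arc, and [p] lies there: it is neither [r j] nor
   [r l], which are outside [f]. *)
apply: (crossed_half IH syme leV (crossed_rev syme cr) eip).
move: pN p2; rewrite !(inE, mem_cat, mem_rcons, mem_rev) (negPf pi) negb_or /=.
move=> pO /andP[/negPf pk /negPf p2]; move: pO; rewrite pk p2 /=.
have /negPf-> : p != r j by apply: contraNneq fj => <-.
have /negPf-> : p != r l by apply: contraNneq fl => <-.
by rewrite orbF.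
Qed.

End CrossedCycle.

(** * Cycles through prescribed vertices *)

Section Absorb.
Variable T : finType.
Implicit Types (e : rel T) (V Y : {set T}) (x y z : T) (p q O : seq T).

(** * Fans with two legs *)

Lemma conn_hit e A (Q : pred T) x y : conn e A x y -> x != y -> Q y -> ~~ Q x ->
  exists q z, [/\ path e x (rcons q z), uniq (x :: rcons q z),
    {subset x :: rcons q z <= A}, Q z & ~~ has Q (x :: q)].
Proof.
move=> cxy xy Qy Qx; have [z [_ xA _ _]] := conn_first cxy xy.
have [p [xp py up sA]] := conn_path cxy xA.
have hp : has Q p.
  apply/hasP; exists y => //; move: (mem_last x p); rewrite py inE.
  by rewrite eq_sym (negPf xy).
case/split_find: hp xp py up sA => u q p2 Qu nQ; rewrite cat_path => /andP[xq _] _.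
rewrite -cat_cons cat_uniq => /andP[uq _] sA; exists q, u; split=> //.
  by move=> v vq; apply: sA; rewrite mem_cat vq.
by rewrite /= negb_or Qx.
Qed.

(** The legs are listed without [x]. A leg may meet [Y] before its end, which [fan_trim] repairs. *)
Definition fan e V Y x p1 p2 :=
  [/\ path e x p1 /\ path e x p2, uniq (x :: p1 ++ p2),
      {subset x :: p1 ++ p2 <= V} & last x p1 \in Y /\ last x p2 \in Y].

Lemma fan_sym e V Y x p1 p2 : fan e V Y x p1 p2 -> fan e V Y x p2 p1.
Proof.
have P : perm_eq (x :: p2 ++ p1) (x :: p1 ++ p2) by rewrite perm_cons perm_catC.
case=> [[xp1 xp2] u sV [l1 l2]]; split=> //; first by rewrite (perm_uniq P).
by move=> z; rewrite (perm_mem P); apply: sV.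
Qed.

(* Whitney's argument: a fan at [x'] is transferred to a neighbour [x] of [x']
   by means of a path from [x] to [Y] that avoids [x']. *)
Lemma fan_exists e V Y :
  (forall s u, u \in V -> u != s -> u \notin Y ->
     exists y, [/\ y \in Y, y != s & conn e (V :\ s) u y]) ->
  forall q z x, path e x (rcons q z) -> uniq (x :: rcons q z) ->
    {subset x :: rcons q z <= V} -> z \in Y -> ~~ has (mem Y) (x :: q) ->
  exists p1 p2, fan e V Y x p1 p2.
Proof.
move=> avoid; elim=> [|x' q IH] z x xq uq sV zY nY.
  have xz : x != z by move: uq; rewrite /= inE andbT.
  have xY : x \notin Y by move: nY; rewrite /= orbF.
  have xV : x \in V by apply: sV; rewrite mem_head.
  have [y [yY yz cxy]] := avoid z x xV xz xY.
  have xy : x != y by apply: contraNneq xY => ->.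
  have [w [t [xw uw sw tY _]]] := conn_hit cxy xy (yY : mem Y y) xY.
  have zw : z \notin x :: rcons w t by apply/negP => /sw; rewrite !inE eqxx.
  exists [:: z], (rcons w t); split=> //=.
  - move: zw uw; rewrite inE negb_or eq_sym => /andP[zx zw] /= /andP[xw' ->].
    by rewrite inE negb_or zx xw' zw.
  - move=> u; rewrite !inE => /or3P[/eqP->//|/eqP->|uw'].
      by apply: sV; rewrite !inE eqxx orbT.
    by have := sw u; rewrite !inE uw' orbT => /(_ isT)/andP[].
  - by rewrite last_rcons.
have [exx' x'q] := andP xq.
have [/= /norP[xx' _] uq'] := andP uq; rewrite -/(rcons q z) in uq'.
have [/norP[xY _] nY'] : ~~ has (mem Y) [:: x] /\ ~~ has (mem Y) (x' :: q).
  by move: nY; rewrite /= orbF negb_or => /andP[].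
have xV : x \in V by apply: sV; rewrite mem_head.
have sV' : {subset x' :: rcons q z <= V} by move=> u uq1; apply: sV;
  rewrite inE uq1 orbT.
have [p1 [p2 F]] := IH z x' x'q uq' sV' zY nY'.
(* If [x] is already on a leg, the rest of that leg is one new leg, and the edge to [x'] followed by
   the other leg is the second. *)
have on_fan p1' p2' : fan e V Y x' p1' p2' -> x \in p1' ->
    exists p1 p2, fan e V Y x p1 p2.
  move=> F' xp; case/splitPr: xp F' => b b' [[]].
  rewrite cat_path /= => /and3P[_ _ xb'] x'p2 u sub [l1 l2].
  rewrite last_cat in l1.
  have S : subseq (x' :: x :: b' ++ p2') (x' :: (b ++ x :: b') ++ p2').
    by rewrite /= eqxx -catA; apply: suffix_subseq.
  have P : perm_eq (x :: b' ++ x' :: p2') (x' :: x :: b' ++ p2').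
    exact/permPl/(perm_catCA (x :: b') [:: x'] p2').
  exists b', (x' :: p2'); split=> //=.
  - by rewrite exx'.
  - by have := subseq_uniq S u; rewrite -(perm_uniq P).
  - by move=> v; rewrite (perm_mem P) => /(mem_subseq S); apply: sub.
have [|xp1] := boolP (x \in p1); first exact: on_fan F.
have [|xp2] := boolP (x \in p2); first exact: on_fan (fan_sym F).
have [y [yY yx' cxy]] := avoid x' x xV xx' xY.
have xy : x != y by apply: contraNneq xY => ->.
(* The path from [x] is followed until it meets the old fan or [Y], whichever comes first. *)
pose Q := [pred u | [|| u \in p1, u \in p2 | u \in Y]].
have Qx : ~~ Q x by rewrite /= !negb_or xp1 xp2.
have Qy : Q y by rewrite /= yY !orbT.
have [w [t [xw uw sw Qt nQ]]] := conn_hit cxy xy Qy Qx.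
have x'w : x' \notin x :: rcons w t by apply/negP => /sw; rewrite !inE eqxx.
have sw' : {subset x :: rcons w t <= V} by move=> u /sw; rewrite !inE => /andP[].
have x'w1 : x' \notin x :: w.
  by move: x'w; rewrite -rcons_cons mem_rcons inE negb_or => /andP[].
have uw1 : uniq (x :: w) by move: uw; rewrite -rcons_cons rcons_uniq => /andP[].
have nQ' u : u \in p1 ++ p2 -> u \notin x :: w.
  rewrite mem_cat => up; apply: contra nQ => uw'; apply/hasP; exists u => //=.
  by rewrite orbA up.
(* Meeting a leg at [t], the path continues along it; the other new leg passes through [x']. *)
have meet p1' p2' : fan e V Y x' p1' p2' -> (forall u, u \in p1' ++ p2' -> u \notin
  x :: w) ->
    t \in p1' -> exists p1 p2, fan e V Y x p1 p2.
  move=> F' nw tp; case/splitPr: tp F' nw => b b' [[]].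
  rewrite cat_path /= => /and3P[_ _ tb'] x'p2 u sub [l1 l2] nw.
  rewrite last_cat in l1.
  have S : subseq (x' :: t :: b' ++ p2') (x' :: (b ++ t :: b') ++ p2').
    by rewrite /= eqxx -catA; apply: suffix_subseq.
  have P : perm_eq (t :: b' ++ x' :: p2') (x' :: t :: b' ++ p2').
    exact/permPl/(perm_catCA (t :: b') [:: x'] p2').
  exists (w ++ t :: b'), (x' :: p2'); split; rewrite /= ?last_cat //.
  - rewrite exx'; split=> //.
    by move: xw; rewrite -cats1 !cat_path /= tb' !andbT.
  - rewrite -[X in is_true X]/(uniq (x :: (w ++ t :: b') ++ x' :: p2')).
    rewrite -catA -cat_cons cat_uniq; apply/and3P; split=> //; last first.
      by rewrite (perm_uniq P) (subseq_uniq S u).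
    apply/hasPn => v; rewrite (perm_mem P) => /(mem_subseq S).
    by rewrite inE => /predU1P[->//|/nw].
  - move=> v; rewrite -catA -cat_cons mem_cat => /orP[vw|].
      by apply: sw'; rewrite -rcons_cons mem_rcons inE vw orbT.
    by rewrite [_ \in _](perm_mem P) => /(mem_subseq S); apply: sub.
have [|tp1] := boolP (t \in p1); first exact: meet F nQ'.
have [|tp2] := boolP (t \in p2).
  by apply: meet (fan_sym F) _ => u; rewrite mem_cat orbC -mem_cat; apply: nQ'.
have tY : t \in Y by move: Qt; rewrite /= (negPf tp1) (negPf tp2).
case: F => [[x'p1 _] u sub [l1 _]].
exists (rcons w t), (x' :: p1); split; rewrite /= ?last_rcons //.
- by rewrite exx'.
- rewrite -[X in is_true X]/(uniq ((x :: rcons w t) ++ (x' :: p1))) cat_uniq.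
  apply/and3P; split=> //; last first.
    have S : subseq (x' :: p1) (x' :: p1 ++ p2) by rewrite /= eqxx prefix_subseq.
    exact: subseq_uniq S u.
  apply/hasPn => v; rewrite inE => /predU1P[->//|vp].
  rewrite -rcons_cons mem_rcons inE negb_or nQ' ?mem_cat ?vp //.
  by rewrite andbT; apply: contraNneq tp1 => <-.
- move=> v; rewrite -cat_cons mem_cat => /orP[/sw'//|].
  by rewrite inE => vp; apply: sub; rewrite inE mem_cat orbA vp.
Qed.

Lemma fan_trim e V Y x p1 p2 : fan e V Y x p1 p2 -> x \notin Y ->
  exists q1 z1 q2 z2,
  [/\ path e x (rcons q1 z1) /\ path e x (rcons q2 z2),
      uniq (x :: rcons q1 z1 ++ rcons q2 z2),
      {subset x :: rcons q1 z1 ++ rcons q2 z2 <= V},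
      z1 \in Y /\ z2 \in Y & ~~ has (mem Y) (x :: q1 ++ q2)].
Proof.
case=> [[xp1 xp2] u sV [l1 l2]] xY.
have hasY p : last x p \in Y -> has (mem Y) p.
  move=> lp; apply/hasP; exists (last x p) => //.
  by have := mem_last x p; rewrite inE => /predU1P[E|//]; rewrite E (negPf xY) in lp.
case/split_find: (hasY _ l1) xp1 u sV => z1 q1 s1 z1Y nq1 xp1 u sV.
case/split_find: (hasY _ l2) xp2 u sV => z2 q2 s2 z2Y nq2 xp2 u sV.
have S : subseq (x :: rcons q1 z1 ++ rcons q2 z2)
    (x :: (rcons q1 z1 ++ s1) ++ (rcons q2 z2 ++ s2)).
  by rewrite /= eqxx; apply: cat_subseq; apply: prefix_subseq.
exists q1, z1, q2, z2; split=> //.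
- by move: xp1 xp2; rewrite !cat_path => /andP[-> _] /andP[-> _].
- exact: subseq_uniq S u.
- by move=> v /(mem_subseq S)/sV.
- by rewrite /= has_cat !negb_or xY nq1.
Qed.

(** * Cycles, their rerouting and the absorption of a root *)

Record is_cycle V e O : Prop := IsCycle {
  is_cycle_cycle : cycle e O;
  is_cycle_uniq : uniq O;
  is_cycle_sub : {subset O <= V};
  is_cycle_size : 2 < size O
}.

Lemma is_cycle_rot V e n O : is_cycle V e O -> is_cycle V e (rot n O).
Proof.
case=> c u s z; split; rewrite ?rot_cycle ?rot_uniq ?size_rot //.
by move=> x; rewrite mem_rot; apply: s.
Qed.

(** The vertices [s] and [t] may coincide, which covers the deletion of a single vertex. *)
Definition connected3 V e := forall s t x y,
  x \in V :\ s :\ t -> y \in V :\ s :\ t -> conn e (V :\ s :\ t) x y.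

(** [arc] contains its start and not its end, so [behead] leaves the open arc, taken in the
    direction of [O] only. *)
Definition unmarked (R : {set T}) O y z := ~~ has (mem R) (behead (arc O y z)).

(** [w] replaces the open arc from [y] to [z], which bears no mark, so all marks stay on the cycle;
    as [w] is not empty, the result still has at least three vertices. *)
Lemma reroute V e (R : {set T}) O y z w : is_cycle V e O -> {subset R <= O} ->
  y \in O -> z \in O -> y != z -> unmarked R O y z ->
  path e y (rcons w z) -> uniq w -> {subset w <= V} -> ~~ has (mem O) w ->
  w != [::] ->
  exists O', [/\ is_cycle V e O', {subset R <= O'} & {subset w <= O'}].
Proof.
move=> cO RO yO zO yz; case: cO => cyc unq sub _.
have [i p1 p2 defp1 _ defO] := rot_to_arc unq yO zO yz.
rewrite /unmarked -defp1 /= => nR yw uw sw wO w0.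
exists (y :: w ++ z :: p2).
have memO u : (u \in y :: p1 ++ z :: p2) = (u \in O) by rewrite -defO mem_rot.
split; last by move=> u uw'; rewrite inE mem_cat uw' orbT.
- split.
  + move: cyc; rewrite -(rot_cycle i) defO /= !rcons_cat /= -!cat_rcons !cat_path.
    by rewrite !last_rcons yw => /andP[].
  + have := unq; rewrite -(rot_uniq i) defO -cat_cons cat_uniq => /and3P[_ _ uz].
    have wO' u : u \in O -> u \notin w by move=> uO; apply: contra wO => uw';
      apply/hasP; exists u.
    have yzp : y \notin z :: p2.
      have := unq; rewrite -(rot_uniq i) defO /= mem_cat negb_or.
      by case/andP=> /andP[].
    rewrite -cat_cons cat_uniq; apply/and3P; split=> //.
      by rewrite /= wO'.
    apply/hasPn => u uz2; rewrite inE negb_or wO' ?andbT.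
      by apply: contraNneq yzp => <-.
    by rewrite -memO inE mem_cat uz2 !orbT.
  + move=> u; rewrite inE mem_cat => /or3P[/eqP->|/sw//|uz]; first exact: sub.
    by apply: sub; rewrite -memO inE mem_cat uz !orbT.
  + by case: (w) w0 => // ? ? _; rewrite /= size_cat /= addnS.
- move=> u uR; have := RO u uR; rewrite -memO !inE !mem_cat.
  case/or3P=> [->//|up|->]; last by rewrite !orbT.
  by case/hasP: nR; exists u.
Qed.

Lemma reroute_sym V e (R : {set T}) O y z w : symmetric e ->
  is_cycle V e O -> {subset R <= O} ->
  y \in O -> z \in O -> y != z -> unmarked R O y z || unmarked R O z y ->
  path e y (rcons w z) -> uniq w -> {subset w <= V} -> ~~ has (mem O) w ->
  w != [::] ->
  exists O', [/\ is_cycle V e O', {subset R <= O'} & {subset w <= O'}].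
Proof.
move=> syme cO RO yO zO yz /orP[um|um] yw uw sw wO w0.
  exact: reroute um yw uw sw wO w0.
have [] := reroute cO RO zO yO _ um (rev_seg syme yw).
- by rewrite eq_sym.
- by rewrite rev_uniq.
- by move=> u; rewrite mem_rev; apply: sw.
- by rewrite has_rev.
- by rewrite -size_eq0 size_rev size_eq0.
- by move=> O' [cO' RO' wO']; exists O'; split=> // u uw'; apply: wO';
  rewrite mem_rev.
Qed.

Lemma unmarked_cycle V e (R : {set T}) y z1 z2 m1 m2 m3 O i :
  is_cycle V e O -> rot i O = y :: m1 ++ z1 :: m2 ++ z2 :: m3 ->
  ~~ (unmarked R O y z1 || unmarked R O z1 y) ->
  ~~ (unmarked R O y z2 || unmarked R O z2 y) ->
  ~~ (unmarked R O z1 z2 || unmarked R O z2 z1) ->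
  [/\ has (mem R) m1, has (mem R) m2 & has (mem R) m3].
Proof.
move=> [_ unq _ _] defO; have memO u : u \in rot i O -> u \in O by rewrite mem_rot.
have unq1 : uniq (rot i O) by rewrite rot_uniq.
have yO : y \in rot i O by rewrite defO mem_head.
have z1O : z1 \in rot i O by rewrite defO !(inE, mem_cat) eqxx !orbT.
have z2O : z2 \in rot i O by rewrite defO !(inE, mem_cat) eqxx !orbT.
rewrite /unmarked -!(arc_rot i unq) ?memO //.
rewrite !negb_or !negbK => /andP[h1 _] /andP[_ h3] /andP[h2 _]; split.
- by move: h1 unq1; rewrite defO => + u; rewrite left_arc.
(* Rotating the list to start at [z1] turns the middle arc into an initial one. *)
- have rotO : rot (size (y :: m1)) (rot i O) = z1 :: m2 ++ z2 :: (m3 ++ y :: m1).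
    by rewrite defO -cat_cons rot_size_cat /= -catA.
  have := unq1; rewrite -(rot_uniq (size (y :: m1))) rotO => u.
  by move: h2; rewrite -(arc_rot (size (y :: m1)) unq1) // rotO left_arc.
- move: h3 unq1; rewrite defO (catA m1 (z1 :: m2)).
  by move=> + u; rewrite right_arc.
Qed.

(** The obstruction to absorbing [r]: the bridge interior [H] attaches to the cycle at three
    vertices that cut it into marked arcs. *)
Definition has_tripod V e (R : {set T}) r := exists y m1 z1 m2 z2 m3 (H : {set T}),
  [/\ is_cycle V e (y :: m1 ++ z1 :: m2 ++ z2 :: m3),
      [/\ has (mem R) m1, has (mem R) m2 & has (mem R) m3],
      [/\ H \subset V, connected e H & r \in H],
      {in H, forall u, u \notin y :: m1 ++ z1 :: m2 ++ z2 :: m3}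
    & [/\ exists2 h, h \in H & e h y, exists2 h, h \in H & e h z1
        & exists2 h, h \in H & e h z2]].

(* Dirac's argument for cycles through prescribed vertices. Induction on the
   length of a path from [r] to the cycle: as long as the bridge containing [r]
   attaches, without a mark in between, to the end [y] of this path and to some
   other vertex, the cycle can be rerouted through the bridge, which shortens
   the path. *)
Lemma absorb V e (R : {set T}) r : symmetric e -> connected3 V e ->
  forall n q O, size q <= n -> path e r q -> {subset r :: q <= V} ->
    last r q \in O -> is_cycle V e O -> {subset R <= O} ->
  (exists O', [/\ is_cycle V e O', {subset R <= O'} & r \in O'])
  \/ has_tripod V e R r.
Proof.
move=> syme c3; elim=> [|n IH] q O.
  case: q => //= _ _ _ rO cO RO; by left; exists O.
move=> szq rq sq lq cO RO.
have [rO|rO] := boolP (r \in O); first by left; exists O.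
have hq : has (mem O) q.
  apply/hasP; exists (last r q) => //; have := mem_last r q.
  by rewrite inE => /predU1P[E|//]; rewrite E (negPf rO) in lq.
case/split_find: hq rq sq szq lq => y q1 q2 yO nq1;
  rewrite cat_path => /andP[rq1 _] sq.
rewrite size_cat size_rcons addSn ltnS => szq _; have {}yO : y \in O := yO.
(* [H] is the component of [r] off the cycle, that is, the interior of its bridge. *)
pose A := V :\: [set z in O]; pose H := [set x in A | conn e A r x].
have rA : r \in A by rewrite !inE rO sq ?mem_head.
have cH : connected e H := connected_component syme rA.
have HO u : u \in H -> u \notin O by rewrite !inE => /andP[/andP[]].
have HV u : u \in H -> u \in V by rewrite !inE => /andP[/andP[_ ->]].
have pH p : path e r p -> {subset p <= V} -> ~~ has (mem O) p -> {subset r :: p <=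
  H}.
  move=> rp sp np; have sA : {subset r :: p <= A}.
    move=> u; rewrite inE => /predU1P[->//|up]; rewrite !inE sp // andbT.
    by apply: contra np => uO; apply/hasP; exists u.
  by move=> u up; rewrite inE sA // (path_conn rp sA up).
pose t := last r q1; have [rq1' ety] : path e r q1 /\ e t y.
  by move: rq1; rewrite rcons_path => /andP[].
have q1H : {subset r :: q1 <= H}.
  by apply: pH => // u uq; apply: sq; rewrite inE mem_cat mem_rcons inE uq !orbT.
have tH : t \in H by apply: q1H; apply: mem_last.
pose N z := [exists h, (h \in H) && e h z].
pose same z1 z2 := unmarked R O z1 z2 || unmarked R O z2 z1.
(* The rerouted cycle passes through [t], the last vertex of the path before [y], so [q1] already
   leads to it. *)
have [/exists_inP[z zO /and3P[zy /exists_inP[h hH ehz] yz]]|] :=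
    boolP [exists z in O, [&& z != y, N z & same y z]].
  have [w [tw lw uw sw]] := conn_path (cH _ _ tH hH) tH.
  have pw : path e y (rcons (t :: w) z) by rewrite /= syme ety rcons_path tw lw.
  have [] // := reroute_sym syme cO RO yO zO _ yz pw uw.
  - by rewrite eq_sym.
  - by move=> u /sw/HV.
  - by apply/hasPn => u /sw/HO.
  move=> O' [cO' RO' wO']; apply: (IH q1 O') => //.
  - by apply: leq_trans szq; apply: leq_addr.
  - by move=> u /q1H/HV.
  - by apply: wO'; rewrite mem_head.
rewrite negb_exists_in => /forall_inP far.
have {}far z : z \in O -> z != y -> N z -> ~~ same y z.
  by move=> zO zy Nz; have := far z zO; rewrite zy Nz.
have third s : exists o, [/\ o \in O, o != y & o != s].
  have [_ uO _ szO] := cO.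
  have /hasP[o oO] : has [pred o | (o != y) && (o != s)] O.
    apply: contraLR szO => /hasPn nO; rewrite -leqNgt.
    apply: (@uniq_leq_size _ O [:: y; s] uO) => o /nO /=.
    by rewrite negb_and !negbK !inE.
  by case/andP; exists o.
(* By 3-connectivity no single vertex separates [r] from the rest of the cycle once [y] is deleted:
   a fan in [V :\ y] yields two further attachments of the bridge. *)
pose Y := [set z in O] :\ y.
have avoid s u : u \in V :\ y -> u != s -> u \notin Y ->
    exists o, [/\ o \in Y, o != s & conn e (V :\ y :\ s) u o].
  move=> uV us _; have [o [oO oy os]] := third s; exists o.
  rewrite !inE oy oO os; split=> //; apply: c3; rewrite in_setD1 ?us //.
  by rewrite os !inE oy; apply: (is_cycle_sub cO).
have rY : r \notin Y by rewrite !inE (negPf rO) andbF.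
have ry : r != y by apply: contraNneq rO => ->.
have rV : r \in V :\ y by rewrite !inE ry sq ?mem_head.
have [o [oY _ cro]] := avoid y r rV ry rY.
have ro : r != o by apply: contraNneq rY => ->.
have {}cro : conn e (V :\ y) r o by apply: connS cro; apply: subD1set.
have [p [z [rp up sp zY nY]]] := conn_hit cro ro (oY : mem Y o) rY.
have [p1 [p2 F]] := fan_exists avoid rp up sp zY nY.
have [{p z rp up sp zY nY F}s1 [z1 [s2 [z2 [[rs1 rs2] us ss [z1Y z2Y] nY]]]]] :=
  fan_trim F rY.
have sO u : u \in s1 ++ s2 -> u \notin O.
  move=> us12; apply: contra nY => uO; apply/hasP; exists u;
    first by rewrite inE us12 orbT.
  have : u \in V :\ y by apply: ss; move: us12;
    rewrite !(inE, mem_cat, mem_rcons) => /orP[]->; rewrite !orbT.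
  by rewrite !inE uO => /andP[->].
have sV u : u \in s1 ++ s2 -> u \in V.
  move=> us12; have : u \in V :\ y by apply: ss; move: us12;
    rewrite !(inE, mem_cat, mem_rcons) => /orP[]->; rewrite !orbT.
  by rewrite inE => /andP[].
have [z1O z1y] : z1 \in O /\ z1 != y by move: z1Y; rewrite !inE => /andP[].
have [z2O z2y] : z2 \in O /\ z2 != y by move: z2Y; rewrite !inE => /andP[].
have z12 : z1 != z2.
  apply: contraTneq us => ->; rewrite cons_uniq cat_uniq negb_and orbC.
  by rewrite has_sym has_rcons /= mem_rcons mem_head /= andbF.
have Nend s z : path e r (rcons s z) -> {subset s <= s1 ++ s2} -> N z.
  rewrite rcons_path => /andP[rs elz] sub; apply/exists_inP; exists (last r s) => //.
  apply: pH (mem_last r s) => //; first by move=> u /sub/sV.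
  by apply/hasPn => u /sub/sO.
have Nz1 : N z1 by apply: Nend rs1 _ => u; rewrite mem_cat => ->.
have Nz2 : N z2 by apply: Nend rs2 _ => u; rewrite mem_cat => ->; rewrite orbT.
(* With no mark between [z1] and [z2] on one side, the two legs joined at [r] replace that arc, and
   [r] itself is absorbed. *)
have [same12|diff12] := boolP (same z1 z2).
  left; pose w := rev s1 ++ r :: s2.
  have Pw : perm_eq w (r :: s1 ++ s2).
    by rewrite /w perm_catC /= perm_cons perm_catC perm_cat2r; apply/permPl/perm_rev.
  have zw : path e z1 (rcons w z2).
    rewrite /w rcons_cat rcons_cons -cat_rcons cat_path last_rcons rs2 andbT.
    exact: rev_seg.
  have [] := reroute_sym syme cO RO z1O z2O z12 same12 zw.
  - rewrite (perm_uniq Pw); apply: subseq_uniq us; rewrite /= eqxx.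
    by apply: cat_subseq; apply: subseq_rcons.
  - move=> u; rewrite (perm_mem Pw) inE => /predU1P[->|/sV//].
    by apply: sq; rewrite mem_head.
  - by apply/hasPn => u; rewrite (perm_mem Pw) inE => /predU1P[->|/sO].
  - by rewrite /w; case: (rev s1).
  move=> O' [cO' RO' wO']; exists O'; split=> //; apply: wO'.
  by rewrite (perm_mem Pw) mem_head.
right.
have tripod i u1 u2 m1 m2 m3 : rot i O = y :: m1 ++ u1 :: m2 ++ u2 :: m3 ->
    ~~ same y u1 -> ~~ same y u2 -> ~~ same u1 u2 -> N u1 -> N u2 -> has_tripod V e
      R r.
  move=> defO d1 d2 d12 /exists_inP[h1 h1H e1] /exists_inP[h2 h2H e2].
  exists y, m1, u1, m2, u2, m3, H; rewrite -defO; split.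
  - exact: is_cycle_rot.
  - exact: unmarked_cycle cO defO d1 d2 d12.
  - split=> //; first by apply/subsetP => u /HV.
    by apply: q1H; rewrite mem_head.
  - by move=> u /HO; rewrite mem_rot.
  - by split; [exists t | exists h1 | exists h2].
have d1 := far _ z1O z1y Nz1; have d2 := far _ z2O z2y Nz2.
have yz1 : y != z1 by rewrite eq_sym.
have [i m1 m2 _ _ defO] := rot_to_arc (is_cycle_uniq cO) yO z1O yz1.
have : z2 \in rot i O by rewrite mem_rot.
rewrite defO inE mem_cat inE (negPf z2y) [z2 == z1]eq_sym (negPf z12) /=.
(* The attachments [z1] and [z2] may follow [y] in either order. *)
case/orP=> z2m; move: defO; case/splitPr: z2m => m m' defO.
  apply: (tripod i z2 z1 m m' m2) => //; first by rewrite defO -catA.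
  by rewrite /same orbC.
exact: (tripod i z1 z2 m1 m m').
Qed.

End Absorb.

(** * Kempe colourings and 2-separations *)

Section Colouring.
Variables (T : finType) (r : 'I_4 -> T).
Implicit Types (e : rel T) (V U A : {set T}) (s t u v x y z : T) (c : T -> 'I_4).

Definition two_coloured V c i j := V :&: [set x | (c x == i) || (c x == j)].

(** The colouring need not be proper, and its values outside [V] are irrelevant. *)
Definition kempe V e c :=
  [/\ forall i, r i \in V, forall i, c (r i) = i
    & forall i j, conn e (two_coloured V c i j) (r i) (r j)].

(** [s] and [t] may coincide or lie outside [V], so that separators of fewer than two vertices are
    included. *)
Definition separated V e U s t := [/\ U \subset V, s \notin U, t \notin U &
  forall u v, u \in U -> v \in V -> v \notin U -> e u v -> v = s \/ v = t].

Lemma separated_sym V e U s t : separated V e U s t -> separated V e U t s.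
Proof. by case=> UV sU tU bd; split=> // u v uU vV vU /(bd u v uU vV vU)[];
  [right|left]. Qed.

(** A walk in [A] can enter and leave [U] only through [w], so each excursion into [U] can be cut
    out. The invariant remembers, while inside [U], that [w] has been reached. *)
Lemma conn_avoid V e U s t A w x y : symmetric e -> separated V e U s t ->
  A \subset V -> (forall v, v \in A -> v = s \/ v = t -> v = w) ->
  x \notin U -> y \notin U -> conn e A x y -> conn e (A :\: U) x y.
Proof.
move=> syme [_ _ _ bd] /subsetP AV Aw xU yU cxy.
set A' := A :\: U.
suff: conn e A' x y \/ (y \in U /\ conn e A' x w) by case=> // -[];
  rewrite (negPf yU).
apply: (conn_inv (Q := fun z => conn e A' x z \/ (z \in U /\ conn e A' x w)) _ cxy);
  last by left; apply: connxx.
move=> u v uA vA euv; have [vU|vU] := boolP (v \in U);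
  have [uU|uU] := boolP (u \in U).
- by case=> [cu|[_ cw]]; right; split=> //; have [xu|xu] := eqVneq x u;
    [rewrite xu uU in xU | have := conn_memr cu xu; rewrite inE uU].
- case=> [cu|[]//]; right; split=> //.
  by rewrite -(Aw u uA) //; apply: (bd v u) => //; [apply: AV | rewrite syme].
- have vw : v = w by apply: Aw => //; apply: (bd u v) => //; apply: AV.
  case=> [cu|[_ cw]]; left; last by rewrite vw.
  have [xu|xu] := eqVneq x u; first by rewrite xu uU in xU.
  by have := conn_memr cu xu; rewrite inE uU.
- case=> [cu|[]//]; left; apply: conn_trans cu _.
  by apply: conn1 => //; rewrite inE ?uU ?vU.
Qed.

Lemma conn_exit V e U s t A x y : separated V e U s t -> A \subset V ->
  x \in U -> y \notin U -> conn e A x y ->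
  exists u v, [/\ u \in A :&: U, v \in A, v = s \/ v = t, e u v & conn e (A :&: U)
    x u].
Proof.
move=> [_ _ _ bd] /subsetP AV xU yU cxy; set G := exists u, _.
suff: (y \in U /\ conn e (A :&: U) x y) \/ G by case=> // -[]; rewrite (negPf yU).
apply: (conn_inv (Q := fun z => (z \in U /\ conn e (A :&: U) x z) \/ G) _ cxy);
  last by left; split=> //; apply: connxx.
move=> u v uA vA euv [[uU cu]|]; last by right.
have uAU : u \in A :&: U by rewrite inE uA.
have [vU|vU] := boolP (v \in U).
  by left; split=> //; apply: conn_trans cu (conn1 _ _ _); rewrite // inE vA.
by right; exists u, v; split=> //; apply: (bd u v) => //; apply: AV.
Qed.

(** Two ways to a smaller graph: a colouring on fewer vertices, or a colouring of [V], perhaps a new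
    one, with a monochromatic edge to contract. *)
Definition reducible V e :=
  (exists V' c, V' \proper V /\ kempe V' e c) \/
  (exists c x y, [/\ kempe V e c, x \in V, y \in V, x != y & e x y /\ c x = c y]).

Lemma two_colouredV V c i j : two_coloured V c i j \subset V.
Proof. exact: subsetIl. Qed.

Lemma in_two_coloured V c i j x :
  (x \in two_coloured V c i j) = (x \in V) && ((c x == i) || (c x == j)).
Proof. by rewrite !inE. Qed.

(* [U] takes the colour of [s] or of [t]: a Kempe chain that crosses [U]
   contains both. *)
Lemma reducible_rootless V e c U s t u : symmetric e -> kempe V e c ->
  separated V e U s t -> u \in U -> (forall i, r i \notin U) -> reducible V e.
Proof.
move=> syme [rV cr kc] sep uU rU.
(* A chain without the colour of [s'] can meet only [t'], so it bypasses [U]; the other chains lose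
   no vertex. *)
have portal s' t' u' : separated V e U s' t' -> u' \in U -> s' \in V -> e u' s' ->
    reducible V e.
  move=> sep' u'U sV eus; have [UV sU tU bd] := sep'.
  pose c' z := if z \in U then c s' else c z.
  right; exists c', u', s'; split=> //; last 3 first.
  - exact: (subsetP UV).
  - by apply: contraTneq u'U => ->.
  - by rewrite /c' u'U (negPf sU).
  split=> // [i|i j]; first by rewrite /c' (negPf (rU i)).
  have [sij|sij] := boolP ((c s' == i) || (c s' == j)).
    apply: connS (kc i j); apply/subsetP => z; rewrite !in_two_coloured /c'.
    by case: ifP => // _ /andP[->].
  have cA : conn e (two_coloured V c i j :\: U) (r i) (r j).
    apply: (conn_avoid syme sep' (two_colouredV _ _ _ _) (w := t')) => // v.
    by rewrite in_two_coloured => /andP[_ cv] [vs|//]; rewrite -vs cv in sij.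
  apply: connS cA; apply/subsetP => z; rewrite inE !in_two_coloured /c'.
  by case/andP=> /negPf->.
have [/existsP[u1 /and3P[u1U sV e1]]|ns] := boolP [exists u1, [&& u1 \in U, s \in V
  & e u1 s]].
  exact: portal sep u1U sV e1.
have [/existsP[u1 /and3P[u1U tV e1]]|nt] := boolP [exists u1, [&& u1 \in U, t \in V
  & e u1 t]].
  exact: portal (separated_sym sep) u1U tV e1.
have [UV sU tU bd] := sep.
(* With no edge from [t] into [U], the vertex [s] alone bounds [U]; chains between roots bypass [U],
   which is deleted. *)
have sep' : separated V e U s s.
  split=> // u1 v u1U vV vU euv; case: (bd u1 v u1U vV vU euv) => [|vt];
    first by left.
  by case/existsP: nt; exists u1; rewrite u1U -vt vV.
left; exists (V :\: U), c; split.
  rewrite properE subsetDl; apply/subsetPn; exists u; first exact: (subsetP UV).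
  by rewrite inE uU.
split=> // [i|i j]; first by rewrite inE rU rV.
rewrite (_ : two_coloured _ _ _ _ = two_coloured V c i j :\: U).
  by apply: (conn_avoid syme sep' (two_colouredV _ _ _ _) (w := s)) => // v _ [].
by apply/setP => z; rewrite !inE andbA.
Qed.

(* The three Kempe chains starting at [r i] leave [U] through [s] or [t], so two
   of them share one of these, which thus has colour [i]; colour [U] with [i]. *)
Lemma reducible_one_root V e c U s t i : symmetric e -> kempe V e c ->
  separated V e U s t -> r i \in U -> (forall j, r j \in U -> j = i) ->
  reducible V e.
Proof.
move=> syme [rV cr kc] sep iU Ui.
have [UV sU tU bd] := sep.
have rU j : j != i -> r j \notin U by apply: contra => /Ui->.
have exit j : j != i ->
    exists u v, [/\ u \in U, v \in V, (c v == i) || (c v == j), v = s \/ v = t & e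
      u v].
  move=> ji; have [u [v []]] := conn_exit sep (two_colouredV _ _ _ _) iU (rU j ji)
    (kc i j).
  rewrite inE => /andP[_ uU]; rewrite in_two_coloured => /andP[vV cv] vst euv _.
  by exists u, v.
have recolour u v : u \in U -> v \in V -> c v = i -> v = s \/ v = t -> e u v ->
    reducible V e.
  move=> uU vV cv vst euv; have vU : v \notin U by case: vst => ->.
  pose c' z := if z \in U then i else c z.
  right; exists c', u, v; split=> //; last 3 first.
  - exact: (subsetP UV).
  - by apply: contraTneq uU => ->.
  - by rewrite /c' uU (negPf vU).
  split=> // [j|j k]; first by rewrite /c'; case: ifP => // /Ui.
  have [/orP ijk|] := boolP ((i == j) || (i == k)).
    apply: connS (kc j k); apply/subsetP => z; rewrite !in_two_coloured /c'.
    by case: ifP => // _ /andP[-> _]; apply/orP.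
  rewrite negb_or => /andP[ij ik].
  have cA : conn e (two_coloured V c j k :\: U) (r j) (r k).
    (* [v] has colour [i] and is off this chain, so [w] is the other one of [s] and [t]. *)
    apply: (conn_avoid syme sep (two_colouredV _ _ _ _) (w := if v == s then t else
      s)).
    - move=> z; rewrite in_two_coloured => /andP[_ cz].
      have zv : z != v by apply: contraTneq cz => ->; rewrite cv negb_or ij.
      case=> zE; first by rewrite -zE [v == z]eq_sym (negPf zv).
      by case: eqP => // vs; case: vst => // vt; rewrite zE vt eqxx in zv.
    - by apply: rU; rewrite eq_sym.
    - by apply: rU; rewrite eq_sym.
    - exact: kc.
  apply: connS cA; apply/subsetP => z; rewrite inE !in_two_coloured /c'.
  by case/andP=> /negPf->.
have share j k u v u' v' : j != k -> u \in U -> v \in V -> v = s \/ v = t -> e u v ->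
    (c v == i) || (c v == j) -> (c v' == i) || (c v' == k) -> v = v' -> reducible V
      e.
  move=> jk uU vV vst euv cv cv' vv'; apply: (recolour u v) => //.
  apply/eqP; case/orP: cv => // /eqP cv; rewrite -vv' cv (negPf jk) orbF in cv'.
  by rewrite cv.
have [j [k [l]]] := ord4_others i.
rewrite /= !inE !negb_or => /and4P[/and3P[ij ik il] /andP[jk jl] kl _].
have ji : j != i by rewrite eq_sym.
have ki : k != i by rewrite eq_sym.
have li : l != i by rewrite eq_sym.
have [u1 [v1 [u1U v1V c1 st1 e1]]] := exit j ji.
have [u2 [v2 [u2U v2V c2 st2 e2]]] := exit k ki.
have [u3 [v3 [u3U v3V c3 st3 e3]]] := exit l li.
have [v12|v12] := eqVneq v1 v2; first exact: (share j k u1 v1 u2 v2).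
have [v13|v13] := eqVneq v1 v3; first exact: (share j l u1 v1 u3 v3).
apply: (share k l u2 v2 u3 v3) => //.
by move: v12 v13; case: st1 => ->; case: st2 => ->; case: st3 => ->; rewrite ?eqxx.
Qed.

(* In [U], the chains from [r i] to [r k] and from [r j] to [r l] end at [s] and
   at [t] respectively, and are disjoint: colour the first one with [i] and the
   rest of [U] with [j]. *)
Lemma reducible_two_roots V e c U s t i j k l : symmetric e -> kempe V e c ->
  separated V e U s t -> uniq [:: i; j; k; l] ->
  [/\ r i \in U, r j \in U, r k \notin U & r l \notin U] ->
  c s = i -> c t = j -> reducible V e.
Proof.
move=> syme [rV cr kc] sep ord [iU jU kU lU] cs ct.
have [UV sU tU bd] := sep.
have := ord; rewrite /= !inE !negb_or => /and4P[/and3P[ij ik il] /andP[jk jl] kl _].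
pose A := two_coloured V c i k :&: U; pose X := [set z in A | conn e A (r i) z].
pose B := two_coloured V c j l :&: U; pose Y := [set z in B | conn e B (r j) z].
pose c' z := if z \in U then if z \in X then i else j else c z.
have iA : r i \in A by rewrite inE iU in_two_coloured rV cr eqxx.
have jB : r j \in B by rewrite inE jU in_two_coloured rV cr eqxx.
have iX : r i \in X by rewrite inE iA connxx.
have jY : r j \in Y by rewrite inE jB connxx.
have cX := connected_component syme iA; have cY := connected_component syme jB.
have XU : {in X, forall z, [&& z \in V, z \in U & c' z == i]}.
  move=> z zX; rewrite /c' zX; move: zX; rewrite inE => /andP[/setIP[+ ->] _].
  by rewrite in_two_coloured eqxx => /andP[->].
have YU : {in Y, forall z, [&& z \in V, z \in U & c' z == j]}.
  move=> z; rewrite inE => /andP[/setIP[+ zU] _];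
    rewrite in_two_coloured => /andP[zV cz].
  rewrite zV zU /c' zU ifN ?eqxx //; apply/negP => zX; have := zX;
    rewrite inE => /andP[/setIP[+ _] _].
  rewrite in_two_coloured => /andP[_ /orP[]/eqP E]; move: cz; rewrite E.
    by rewrite (negPf ij) (negPf il).
  by rewrite eq_sym (negPf jk) (negPf kl).
have [u [v [uA vA vst euv cu]]] := conn_exit sep (two_colouredV _ _ _ _) iU kU (kc
  i k).
(* The exit is not [t], whose colour [j] does not occur on the chain from [r i] to [r k]. *)
have {vst vA} [vs sV] : v = s /\ s \in V.
  case: vst vA => ->; rewrite in_two_coloured => /andP[vV] //.
  by rewrite ct eq_sym (negPf ij) (negPf jk).
rewrite {}vs in euv; have uX : u \in X by rewrite inE uA cu.
have [u' [v' [uB vB vst eut cu']]] := conn_exit sep (two_colouredV _ _ _ _) jU lU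
  (kc j l).
have {vst vB} [vt tV] : v' = t /\ t \in V.
  case: vst vB => ->; rewrite in_two_coloured => /andP[vV] //.
  by rewrite cs (negPf ij) (negPf il).
rewrite {}vt in eut; have uY : u' \in Y by rewrite inE uB cu'.
have out a b : two_coloured V c a b :\: U \subset two_coloured V c' a b.
  by apply/subsetP => z; rewrite inE !in_two_coloured /c' => /andP[/negPf->].
(* From [r a] the new chain runs in [Z] to [p], then follows the old chain from [p] to [r m], which
   bypasses [U] because [q] is coloured neither [a] nor [m]. *)
have through a m p q Z w : r a \in U -> r m \notin U -> separated V e U p q ->
    c p = a -> c q != a -> c q != m -> p \in V -> connected e Z -> r a \in Z -> w
      \in Z ->
    e w p -> {in Z, forall z, [&& z \in V, z \in U & c' z == a]} ->
    conn e (two_coloured V c' a m) (r a) (r m).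
  move=> aU mU sep' cp cqa cqm pV cZ aZ wZ ewp ZU.
  have [UV' pU qU bd'] := sep'.
  have only : forall z, z \in two_coloured V c a m -> z = p \/ z = q -> z = p.
    move=> z + [//|zq]; rewrite in_two_coloured zq.
    by rewrite (negPf cqa) (negPf cqm) andbF.
  have [x [y [xA yA yst exy cx]]] := conn_exit sep' (two_colouredV _ _ _ _) aU mU
    (kc a m).
  have {yst} yp := only y yA yst; rewrite {}yp in yA exy.
  have cpm : conn e (two_coloured V c a m) p (r m).
    apply: conn_trans (kc a m); apply: conn_sym => //.
    apply: conn_trans (connS (subsetIl _ _) cx) _; apply: conn1 => //.
    by move: xA; rewrite inE => /andP[].
  have := conn_avoid syme sep' (two_colouredV _ _ _ _) only pU mU cpm.
  move/(connS (out a m)); apply: conn_trans.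
  have ZA : Z \subset two_coloured V c' a m.
    by apply/subsetP => z /ZU/and3P[zV _ cz]; rewrite in_two_coloured zV cz.
  apply: conn_trans (connS ZA (cZ _ _ aZ wZ)) (conn1 _ _ _) => //.
    exact: (subsetP ZA).
  by rewrite in_two_coloured pV /c' (negPf pU) cp eqxx.
have sep2 := separated_sym sep.
(* The vertex [u] of [X] and its neighbour [s] now both have colour [i]. *)
right; exists c', u, s; split=> //; last 3 first.
- by case/and3P: (XU u uX).
- by apply: contraNneq sU => <-; case/and3P: (XU u uX).
- by split=> //; case/and3P: (XU u uX) => _ _ /eqP->; rewrite /c' (negPf sU).
split=> //.
- move=> a; have := ord4_uniq ord a; rewrite !inE => /or4P[]/eqP->.
  + by case/and3P: (XU _ iX) => _ _ /eqP.
  + by case/and3P: (YU _ jY) => _ _ /eqP.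
  + by rewrite /c' (negPf kU) cr.
  + by rewrite /c' (negPf lU) cr.
have ji : j != i by rewrite eq_sym.
apply: (ord4_pairs ord).
- move=> a b cab; apply: conn_sym => //.
  rewrite (_ : two_coloured _ _ _ _ = two_coloured V c' a b) //.
  by apply/setP => z; rewrite !in_two_coloured orbC.
- by move=> a; apply: connxx.
- split.
  (* All of [U] is now coloured [i] or [j], so the old chain survives. *)
  + apply: connS (kc i j); apply/subsetP => z; rewrite !in_two_coloured /c'.
    by case/andP=> -> cz; case: ifP => // _; case: ifP; rewrite !eqxx ?orbT.
  + by apply: (through i k s t X u); rewrite ?cs ?ct.
  + by apply: (through i l s t X u); rewrite ?cs ?ct.
split.
- by apply: (through j k t s Y u'); rewrite ?cs ?ct.
- by apply: (through j l t s Y u'); rewrite ?cs ?ct.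
apply: connS (out k l) _.
apply: (conn_avoid syme sep (two_colouredV _ _ _ _) (w := s)) => // z.
rewrite in_two_coloured => /andP[_ cz] [//|zt]; move: cz; rewrite zt ct.
by rewrite (negPf jk) (negPf jl).
Qed.

End Colouring.

(** * From Kempe colourings to models *)

Section Main.
Variables (T : finType) (r : 'I_4 -> T).
Implicit Types (e : rel T) (V U A : {set T}) (s t u v x y z : T) (c : T -> 'I_4).

(** With [U] the component of [x] and [W] the rest, each side contains two roots, or one of the
    preceding lemmas applies. Each of the four chains between roots on different sides passes
    through [s] or [t], so the two colours of [s] and [t] form a vertex cover of a 4-cycle on the
    indices. They are thus the colours of the two roots on one side, and [reducible_two_roots]
    applies to that side. *)
Lemma reducible_separated V e c s t x y : symmetric e -> kempe r V e c ->
  x \in V :\ s :\ t -> y \in V :\ s :\ t -> ~~ conn e (V :\ s :\ t) x y ->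
  reducible r V e.
Proof.
move=> syme kmp; set S := V :\ s :\ t => xS yS ncxy.
have [rV cr kc] := kmp.
pose U := [set z in S | conn e S x z]; pose W := S :\: U.
have SV z : z \in S -> [/\ z \in V, z != s & z != t] by rewrite !inE => /and3P[->
  ->].
have US z : z \in U -> z \in S by rewrite inE => /andP[].
have WS z : z \in W -> z \in S by rewrite inE => /andP[].
have stN (Z : {set T}) : (forall z, z \in Z -> z \in S) -> [/\ Z \subset V, s
  \notin Z & t \notin Z].
  move=> ZS; split; first by apply/subsetP => z /ZS/SV[].
    by apply/negP => /ZS/SV[]; rewrite eqxx.
  by apply/negP => /ZS/SV[]; rewrite eqxx.
have inS v : v \in V -> v \notin S -> v = s \/ v = t.
  move=> vV; rewrite !inE vV andbT -negb_or negbK orbC.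
  by case/orP=> /eqP; [left|right].
have UW u v : u \in U -> v \in S -> e u v -> v \in U.
  rewrite inE => /andP[uS cu] vS euv; rewrite inE vS.
  by apply: conn_trans cu (conn1 _ _ _).
have sepU : separated V e U s t.
  have [UV sU tU] := stN U US; split=> // u v uU vV vU euv.
  by apply: inS => //; apply: contra vU => vS; apply: UW euv.
have sepW : separated V e W s t.
  have [WV sW tW] := stN W WS; split=> // u v uW vV vW euv.
  apply: inS => //; apply: contra vW => vS; rewrite inE vS andbT.
  by apply: contraL (uW) => vU; rewrite inE negb_and negbK (UW v u) ?WS // syme.
have xU : x \in U by rewrite inE xS connxx.
have yW : y \in W by rewrite in_setD yS andbT inE (negPf ncxy) andbF.
have few (Z : {set T}) z : separated V e Z s t -> z \in Z ->
    reducible r V e \/ exists i j, [/\ i != j, r i \in Z & r j \in Z].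
  move=> sepZ zZ; case: (pickP (fun i => r i \in Z)) => [i iZ|noZ]; last first.
    by left; apply: reducible_rootless kmp sepZ zZ _ => // i; rewrite noZ.
  case: (pickP (fun j => (i != j) && (r j \in Z))) => [j /andP[ij jZ]|noZ].
    by right; exists i, j.
  left; apply: reducible_one_root kmp sepZ iZ _ => // j jZ.
  by apply/eqP; have := noZ j; rewrite jZ andbT eq_sym => /negbFE.
have [//|[i [j [ij iU jU]]]] := few U x sepU xU.
have [//|[k [l [kl kW lW]]]] := few W y sepW yW.
have [kU lU] : r k \notin U /\ r l \notin U.
  by move: kW lW; rewrite !in_setD => /andP[-> _] /andP[-> _].
have [iW jW] : r i \notin W /\ r j \notin W by rewrite !in_setD iU jU.
have neq a b : r a \in U -> r b \notin U -> a != b.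
  by move=> aU; apply: contraNneq => <-.
have [ik il jk jl] : [/\ i != k, i != l, j != k & j != l] by split; apply: neq.
have ord : uniq [:: i; j; k; l] by rewrite /= !inE !negb_or ij ik il jk jl kl.
have hit a m : r a \in U -> r m \notin U ->
    [|| c s == a, c s == m, c t == a | c t == m].
  move=> aU mU; have [u [v [_ + + _ _]]] := conn_exit sepU (two_colouredV _ _ _ _)
    aU mU (kc a m).
  by rewrite in_two_coloured => /andP[_ cv] [] <-; case/orP: cv => ->; rewrite ?orbT.
have done a b p q s' t' (Z : {set T}) : separated V e Z s' t' -> uniq [:: a; b; p;
  q] ->
    [/\ r a \in Z, r b \in Z, r p \notin Z & r q \notin Z] ->
    c s' = a -> c t' = b -> reducible r V e.
  by move=> sepZ o rZ ca cb; apply: reducible_two_roots kmp sepZ o rZ ca cb.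
have sepU' := separated_sym sepU; have sepW' := separated_sym sepW.
have ordW : uniq [:: k; l; i; j] by rewrite (uniq_catC [:: k; l] [:: i; j]).
have h1 := hit i k iU kU; have h2 := hit i l iU lU.
have h3 := hit j k jU kU; have h4 := hit j l jU lU.
have {}hit : [|| (c s == i) && (c t == j), (c s == j) && (c t == i),
    (c s == k) && (c t == l) | (c s == l) && (c t == k)].
  have := ord4_uniq ord (c s); have := ord4_uniq ord (c t).
  have ji := ij; rewrite eq_sym in ji; have ki := ik; rewrite eq_sym in ki.
  have li := il; rewrite eq_sym in li; have kj := jk; rewrite eq_sym in kj.
  have lj := jl; rewrite eq_sym in lj; have lk := kl; rewrite eq_sym in lk.
  move: h1 h2 h3 h4; rewrite !inE.
  have E := (eqxx, negPf ij, negPf ik, negPf il, negPf jk, negPf jl, negPf kl,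
    negPf ji, negPf ki, negPf li, negPf kj, negPf lj, negPf lk).
  by move=> + + + + /or4P[]/eqP ct /or4P[]/eqP cs; rewrite cs ct !E.
case/or4P: hit => /andP[/eqP cs /eqP ct].
- exact: (done i j k l s t U).
- exact: (done i j k l t s U).
- exact: (done k l i j s t W).
- exact: (done k l i j t s W).
Qed.

(** Since [x] and [y] share a colour, a two-coloured set containing [y] contains [x], as
    [conn_contract] demands. *)
Lemma kempe_contract V e c x y : symmetric e -> kempe r V e c ->
  x \in V -> x != y -> c x = c y -> (forall i, r i != y) ->
  kempe r (V :\ y) (contract e x y) c.
Proof.
move=> syme [rV cr kc] xV xy cxy ry; split=> // [i|i j].
  by rewrite !inE ry rV.
rewrite (_ : two_coloured _ _ _ _ = two_coloured V c i j :\ y).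
  by apply: conn_contract => //; rewrite !in_two_coloured xV cxy => /andP[_ ->].
by apply/setP => z; rewrite !inE andbA.
Qed.

Lemma filter_split (P : pred T) (s : seq T) x l : filter P s = x :: l ->
  exists s1 s2 : seq T, s = s1 ++ x :: s2 /\ filter P s2 = l.
Proof.
elim: s => //= y s IH; case: ifP => _ => [[<- <-]|/IH[s1 [s2 [-> fs2]]]].
  by exists [::], s.
by exists (y :: s1), s2.
Qed.

Lemma path_rcons_cat e x y z (p q : seq T) :
  path e x (rcons (p ++ y :: q) z) = path e x (rcons p y) && path e y (rcons q z).
Proof. by rewrite rcons_cat rcons_cons -cat_rcons cat_path last_rcons. Qed.

Lemma model_hamilton V e c O : symmetric e -> kempe r V e c -> is_cycle V e O ->
  (forall i, r i \in O) -> model r V e.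
Proof.
move=> syme [rV cr kc] [cO uO sO _] rO.
(* Only the root of index [c z] can be [z], so [P] recognises the roots. *)
pose P := [pred z | r (c z) == z].
have rP i : P (r i) by rewrite /= cr.
pose L := map c (filter P O).
have rL : map r L = filter P O.
  rewrite -map_comp -[RHS]map_id; apply/eq_in_map => z.
  by rewrite mem_filter => /andP[/eqP].
have uL : uniq L by apply: (@map_uniq _ _ r); rewrite rL filter_uniq.
have allL i : i \in L.
  by apply/mapP; exists (r i); rewrite ?cr // mem_filter rP rO.
have szL : size L = 4.
  rewrite -(card_uniqP uL) -[RHS](card_ord 4); apply: eq_card => i.
  by rewrite allL.
case: L rL uL szL allL => [|i [|j [|k [|l []]]]] //= /esym fO ord _ _.
have {fO} [b0 [O1 [defO fO]]] := filter_split fO.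
have {fO} [a1 [O2 [defO1 fO]]] := filter_split fO.
have {fO} [a2 [O3 [defO2 fO]]] := filter_split fO.
have {fO} [a3 [a4 [defO3 _]]] := filter_split fO.
(* The part [b0] before the first root goes to the end of the last arc. *)
have defR : rot (size b0) O
    = (r i :: a1) ++ (r j :: a2) ++ (r k :: a3) ++ (r l :: a4 ++ b0).
  by rewrite defO rot_size_cat defO1 defO2 defO3 /= -!catA /= -!catA /= -!catA.
move: cO uO; rewrite -(rot_cycle (size b0)) -(rot_uniq (size b0)) defR => cO uO.
have paths : [/\ path e (r i) (rcons a1 (r j)), path e (r j) (rcons a2 (r k)),
    path e (r k) (rcons a3 (r l)) & path e (r l) (rcons (a4 ++ b0) (r i))].
  by move: cO; rewrite /= !path_rcons_cat => /and4P.
have [ij jk kl li] := paths.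
(* Here [i], [j], [k], [l] is the order of the roots along the cycle, so [f] selects the colours of
   two opposite roots. *)
apply: (@model_crossed _ r #|V| V e (fun z => (c z == i) || (c z == k)) i j k l
  a1 a2 a3 (a4 ++ b0)) => //.
split=> //.
- by move=> z; rewrite -defR mem_rot; apply: sO.
- exact: kc.
apply: connS (kc j l); apply/subsetP => z; rewrite in_two_coloured !inE.
move: ord; rewrite /= !inE !negb_or => /and4P[/and3P[nij nik nil] /andP[njk njl]
  nkl _].
case/andP=> -> /orP[]/eqP->.
  by rewrite [j == i]eq_sym nij njk.
by rewrite [l == i]eq_sym [l == k]eq_sym nil nkl.
Qed.

(** The three arcs of the cycle and [H] are the branch sets: each arc contains a mark, which is a
    root, and the roots are distinct because the sets are disjoint. *)
Lemma model_tripod V e (R : {set T}) (l : 'I_4) : symmetric e ->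
  {in R, forall z, exists i, r i = z} -> has_tripod V e R (r l) -> model r V e.
Proof.
move=> syme Rr [y [m1 [z1 [m2 [z2 [m3 [H [[cO uO sO _] [h1 h2 h3] [HV cH lH] HO [ay
  az1 az2]]]]]]]]].
have root m : has (mem R) m -> exists i, r i \in m.
  by case/hasP=> z zm zR; have [i ri] := Rr z zR; exists i; rewrite ri.
have [[i im] [j jm] [k km]] := And3 (root _ h1) (root _ h2) (root _ h3).
have defO : y :: m1 ++ z1 :: m2 ++ z2 :: m3 = (y :: m1) ++ (z1 :: m2) ++ (z2 :: m3)
  by [].
rewrite defO in cO uO sO HO.
have [paths1 paths2 paths3] : [/\ path e y (rcons m1 z1), path e z1 (rcons m2 z2) &
    path e z2 (rcons m3 y)].
  by move: cO; rewrite /= !path_rcons_cat => /and3P.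
have d12 : [disjoint [set z in y :: m1] & [set z in z1 :: m2]].
  by apply: disjoint_list; move: uO; rewrite catA cat_uniq => /andP[].
have d23 : [disjoint [set z in z1 :: m2] & [set z in z2 :: m3]].
  by apply: disjoint_list; move: uO; rewrite cat_uniq => /and3P[].
have d13 : [disjoint [set z in y :: m1] & [set z in z2 :: m3]].
  by apply: disjoint_list; apply: subseq_uniq uO;
    rewrite cat_subseq // suffix_subseq.
have dH (s : seq T) : {subset s <= (y :: m1) ++ (z1 :: m2) ++ (z2 :: m3)} ->
    [disjoint [set z in s] & H].
  move=> sub; rewrite disjoint_sym disjoint_subset; apply/subsetP => z zH.
  by rewrite !inE; apply: contra (HO z zH) => /sub.
have sub1 : {subset y :: m1 <= (y :: m1) ++ (z1 :: m2) ++ (z2 :: m3)}.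
  by move=> z zm; rewrite mem_cat zm.
have sub2 : {subset z1 :: m2 <= (y :: m1) ++ (z1 :: m2) ++ (z2 :: m3)}.
  by move=> z zm; rewrite !mem_cat zm orbT.
have sub3 : {subset z2 :: m3 <= (y :: m1) ++ (z1 :: m2) ++ (z2 :: m3)}.
  by move=> z zm; rewrite !mem_cat zm !orbT.
have im' : r i \in [set z in y :: m1] by rewrite !inE im orbT.
have jm' : r j \in [set z in z1 :: m2] by rewrite !inE jm orbT.
have km' : r k \in [set z in z2 :: m3] by rewrite !inE km orbT.
have neq a b (A B : {set T}) : [disjoint A & B] -> r a \in A -> r b \in B -> a != b.
  by move=> dAB aA; apply: contraTneq => <-; rewrite (disjointFr dAB aA).
have ord : uniq [:: i; j; k; l].
  rewrite /= !inE !negb_or (neq _ _ _ _ d12 im' jm') (neq _ _ _ _ d13 im' km').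
  rewrite (neq _ _ _ _ d23 jm' km') (neq _ _ _ _ (dH _ sub1) im' lH).
  by rewrite (neq _ _ _ _ (dH _ sub2) jm' lH) (neq _ _ _ _ (dH _ sub3) km' lH).
have HA (s : seq T) x : (exists2 h, h \in H & e h x) -> adjacent e [set z in x ::
  s] H.
  by case=> h hH ehx; exists x, h; rewrite inE mem_head syme.
apply: (model_intro syme ord (A := [set z in y :: m1]) (B := [set z in z1 :: m2])
  (C := [set z in z2 :: m3]) (D := H)).
- by split=> //; apply/subsetP => z; rewrite in_set => zm; apply: sO;
    [apply: sub1 | apply: sub2 | apply: sub3].
- by split.
- move: paths1 paths2 paths3; rewrite !rcons_path.
  by move=> /andP[p1 _] /andP[p2 _] /andP[p3 _]; split=> //; apply: connected_path.
- by split=> //; apply: dH.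
- by split=> //; apply: dH.
- split; [exact: adjacent_list | | exact: HA].
  by apply: adjacent_sym => //; apply: adjacent_list.
- by split; [exact: adjacent_list | exact: HA | exact: HA].
Qed.

(** Induction on the number of roots off the cycle: each step absorbs one of them or ends with a
    tripod. *)
Lemma model_connected3 V e c O : symmetric e -> kempe r V e c ->
  connected3 V e -> is_cycle V e O -> model r V e.
Proof.
move=> syme kmp c3; have [rV cr _] := kmp.
have [m] := ubnP #|[set i | r i \notin O]|.
elim: m O => // m IH O leO cO.
have [/forallP rO|] := boolP [forall i, r i \in O];
  first exact: model_hamilton kmp cO rO.
case/forallPn=> l lO; have [_ uO sO szO] := cO.
pose R := [set z in O | [exists i, r i == z]].
have RO : {subset R <= O} by move=> z; rewrite inE => /andP[].
have [o [o' [oO o'O oo']]] : exists o o', [/\ o \in O, o' \in O & o != o'].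
  case: (O) uO szO => [|o [|o' q]] //= /andP[+ _] _; rewrite inE negb_or.
  by case/andP=> oo' _; exists o, o'; rewrite !inE !eqxx orbT.
(* Only a path from [r l] to the cycle is wanted; the deletion of [o] is forgotten at once. *)
have clo' : conn e (V :\ o :\ o) (r l) o'.
  apply: c3; rewrite !inE ?rV ?andbT ?sO ?[o' == o]eq_sym ?oo' //.
  by rewrite andbb; apply: contraNneq lO => ->.
have VoV : V :\ o :\ o \subset V by exact: subset_trans (subD1set _ _) (subD1set _
  _).
have [q [lq qo' _ sq]] := conn_path (connS VoV clo') (rV l).
have lqO : last (r l) q \in O by rewrite qo'.
have [] := absorb syme c3 (leqnn _) lq sq lqO cO RO; last first.
  by apply: model_tripod => // z; rewrite inE => /andP[_ /existsP[i /eqP]]; exists i.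
case=> O' [cO' RO' lO']; rewrite ltnS in leO; apply: IH cO'; apply: leq_trans leO.
apply: proper_card; rewrite properE; apply/andP; split.
  apply/subsetP => i; rewrite !inE; apply: contra => iO; apply: RO'.
  by rewrite inE iO; apply/existsP; exists i.
by apply/subsetPn; exists l; rewrite inE ?lO'.
Qed.

(** The chains from a root give it neighbours of each other colour. Two of them, joined by a path
    that avoids the root, close a cycle, and their distinct colours make it long enough. *)
Lemma exists_cycle V e c : symmetric e -> kempe r V e c -> connected3 V e ->
  {in V &, forall x y, x != y -> e x y -> c x != c y} -> exists O, is_cycle V e O.
Proof.
move=> syme [rV cr kc] c3 proper.
have neigh (i j : 'I_4) : i != j -> exists x, [/\ x \in V, x != r i, e (r i) x & c
  x = j].
  move=> ij; have rij : r i != r j by apply: contra_neq ij => E;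
    rewrite -[i]cr -[j]cr E.
  have [x []] := conn_first (kc i j) rij; rewrite !in_two_coloured.
  move=> /andP[xV cx] _ xi eix; exists x; split=> //; apply/eqP.
  case/orP: cx => // /eqP cx; have := proper _ _ (rV i) xV _ eix.
  by rewrite eq_sym xi cr cx eqxx => /(_ isT).
have [i [j [k [l]]]] : exists i j k l : 'I_4, uniq [:: i; j; k; l].
  by have [j [k [l o]]] := ord4_others ord0; exists ord0, j, k, l.
rewrite /= !inE !negb_or => /and4P[/and3P[ij ik _] /andP[jk _] _ _].
have [x [xV xi eix cx]] := neigh i j ij; have [y [yV yi eiy cy]] := neigh i k ik.
have cxy : conn e (V :\ r i :\ r i) x y by apply: c3; rewrite !inE ?xi ?yi ?xV ?yV.
have xS : x \in V :\ r i :\ r i by rewrite !inE xi xV.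
have [p [xp py up sp]] := conn_path cxy xS; exists (r i :: x :: p); split.
- by rewrite /= eix rcons_path xp py syme.
- rewrite cons_uniq up andbT; apply: contraL (mem_head (r i) [::]) => /sp.
  by rewrite !inE eqxx.
- by move=> z; rewrite inE => /predU1P[->//|/sp]; rewrite !inE => /and3P[].
- case: p py {xp up sp} => //= xy; move: jk.
  by rewrite -cx -cy xy eqxx.
Qed.

Lemma model_kempe n V e c : symmetric e -> #|V| <= n -> kempe r V e c -> model r V e.
Proof.
elim: n V e c => [|n IH] V e c syme leV kmp.
  have [rV _ _] := kmp; move: leV; rewrite leqn0 cards_eq0 => /eqP V0.
  by have := rV ord0; rewrite V0 inE.
have reduce : reducible r V e -> model r V e.
  case=> [[V' [c' [V'V kmp']]]|[c' [x [y [kmp' xV yV xy [exy cxy]]]]]].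
    apply: modelS (proper_sub V'V) (IH V' e c' syme _ kmp').
    by rewrite -ltnS (leq_trans (proper_card V'V) leV).
  have step x' y' : x' \in V -> y' \in V -> x' != y' -> e x' y' -> c' x' = c' y' ->
      (forall i, r i != y') -> model r V e.
    move=> x'V y'V xy' exy' cxy' ry'; apply: (model_contract syme exy') => //.
    apply: (IH _ _ c').
    - exact: contract_sym.
    - by move: leV; rewrite (cardsD1 y' V) y'V.
    - exact: kempe_contract.
  have [/forallP ry|] := boolP [forall i, r i != y]; first exact: (step x y).
  case/forallPn=> i; rewrite negbK => /eqP riy.
  (* If [y] is a root then [x] is not, as roots have distinct colours: the contraction goes towards
     [y]. *)
  apply: (step y x) => //; rewrite 1?eq_sym // 1?syme // => j.
  have [_ cr _] := kmp'; apply: contra_neq xy => rjx.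
  by rewrite -rjx -riy -[j]cr rjx cxy -riy cr.
have [/existsP[x /existsP[y /and5P[xV yV xy exy /eqP cxy]]]|mono] :=
    boolP [exists x, exists y, [&& x \in V, y \in V, x != y, e x y & c x == c y]].
  by apply: reduce; right; exists c, x, y.
have [c3|] := boolP [forall s, forall t, forall x in V :\ s :\ t,
    forall y in V :\ s :\ t, conn e (V :\ s :\ t) x y]; last first.
  case/forallPn=> s /forallPn[t]; rewrite negb_forall_in => /exists_inP[x xS].
  rewrite negb_forall_in => /exists_inP[y yS].
  by move/(reducible_separated syme kmp xS yS)/reduce.
have {}c3 : connected3 V e.
  by move=> s t x y xS yS;
    move/forallP/(_ s)/forallP/(_ t)/forall_inP/(_ x xS)/forall_inP/(_ y yS): c3.
have [|O cO] := exists_cycle syme kmp c3; last exact: model_connected3 kmp c3 cO.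
move=> x y xV yV xy exy; apply: contra mono => cxy.
by apply/existsP; exists x; apply/existsP; exists y; apply/and5P.
Qed.

End Main.

(** * Schemes as Kempe colourings, models as rooted minors *)

Lemma kempe_of_scheme (G : sgraph) (i : complete_graph 4 -> G) :
  has_scheme i -> exists c : G -> 'I_4, kempe i [set: G] (@adj G) c.
Proof.
case=> P [pathP starP].
pose F x := [set E in edges (complete_graph 4) | x \in P E].
have starF x : exists u : 'I_4, [forall E in F x, u \in E].
  have [F0|F0] := eqVneq (F x) set0.
    (* Vertices on no path of the scheme may take any colour. *)
    by exists ord0; apply/forall_inP => E; rewrite F0 inE.
  have sF : F x \subset edges (complete_graph 4).
    by apply/subsetP => E; rewrite inE => /andP[].
  have [|u uF] := starP (F x) sF F0; last by exists u; apply/forall_inP.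
  by exists x => E; rewrite inE => /andP[].
pose c x := xchoose (starF x).
have cF x E : E \in F x -> c x \in E by move: E; apply/forall_inP;
  apply: (xchooseP (starF x)).
have edge (u v : 'I_4) : u != v -> [set u; v] \in edges (complete_graph 4).
  by move=> uv; rewrite inE; apply/existsP; exists u; apply/existsP; exists v;
    rewrite eqxx andbT.
have endP (u v : 'I_4) : u != v -> i u \in P [set u; v].
  move=> uv; have [_ /setP/(_ (i u))] := pathP u v uv.
  by rewrite !inE eqxx => /andP[].
exists c; split=> // [u|u v].
  (* [i u] lies on the paths of two edges at [u] with different other ends, so its colour can only
     be [u]. *)
  have [v [w [z]]] := ord4_others u.
  rewrite /= !inE !negb_or => /and4P[/and3P[uv uw _] /andP[vw _] _ _].
  have cv : c (i u) \in [set u; v] by apply: cF; rewrite inE edge // endP.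
  have cw : c (i u) \in [set u; w] by apply: cF; rewrite inE edge // endP.
  move: cv cw; rewrite !inE => /orP[/eqP//|/eqP->].
  by rewrite eq_sym (negPf uv) (negPf vw).
have [->|uv] := eqVneq u v; first exact: connxx.
have sub : {subset P [set u; v] <= two_coloured [set: G] c u v}.
  move=> x xP; rewrite in_two_coloured inE.
  have /cF : [set u; v] \in F x by rewrite in_set edge ?xP.
  by rewrite !inE.
have conn_from a b s : {subset s <= two_coloured [set: G] c u v} ->
    path_from_to a b s -> conn (@adj G) (two_coloured [set: G] c u v) a b.
  move=> ss [p [defs ap <- _]]; rewrite defs in ss.
  exact: (path_conn ap ss (mem_last _ _)).
have [[ipath|ipath] _] := pathP u v uv; first exact: conn_from sub ipath.
by apply: conn_sym (conn_from _ _ _ sub ipath); apply: adj_sym.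
Qed.

(** Each branch set carries its induced subgraph. *)
Lemma rooted_minor_of_model (G : sgraph) (i : complete_graph 4 -> G) :
  model i [set: G] (@adj G) -> has_rooted_minor i.
Proof.
case=> M [_ iM cM dM aM].
have sym v : symmetric (fun x y => [&& x \in M v, y \in M v & adj x y]).
  by move=> x y; rewrite adj_sym andbCA.
have vert v x y : [&& x \in M v, y \in M v & adj x y] -> (x \in M v) && (y \in M v).
  by case/and3P=> -> ->.
have adjM v x y : [&& x \in M v, y \in M v & adj x y] -> adj x y by case/and3P.
exists (fun v => Subgraph (sym v) (vert v) (@adjM v)); split=> //= v.
by split; [apply/set0Pn; exists (i v) | apply: cM].
Qed.

Theorem theorem5p1 : contractible (complete_graph 4).
Proof.
move=> G i _ /kempe_of_scheme[c kmp]; apply: rooted_minor_of_model.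
exact: model_kempe (@adj_sym G) (leqnn _) kmp.
Qed.
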